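(* Let $H$ be a finite-dimensional Hopf algebra over a field $\Bbbk$ with antipode $S$, let $\mu\in H^*$ be the distinguished grouplike element of $H^*$, and let $(A,\rho_A)$ be a right $H$-comodule algebra. Fix an invertible element $\mathcal{A}\in A$ satisfying $a\mathcal{A}=\mu(a_1)\mathcal{A}a_0$ for every $a\in A$, a left integral $\Lambda\in H$ and a right integral $\lambda\in H^*$ such that $\lambda(\Lambda)=1$. Then all Frobenius pairs $(B',\mathfrak{t}')$ for the cowreath $(A\otimes H^{\mathrm{op}},H,\psi)$ are given by $$B'(h\otimes h')=\lambda\bigl(S(\overline{u}_2S^{-1}(h'_1)h\,\overline{b}_1\mathcal{A}^{-1}_1)\bigr)\,\overline{b}_0\mathcal{A}^{-1}_0\otimes h'_3\overline{u}_1S^{-1}(h'_2),$$ $$\mathfrak{t}'=\mathcal{A}b\otimes\Lambda_2uS^{-1}(\Lambda_1)\otimes\Lambda_3,$$ with $b\otimes u\in (C_{A\otimes H^{\mathrm{op}}}(coH))^{\times}$ and $\overline{b}\otimes\overline{u}=(b\otimes u)^{-1}$. Here $\rho_A(\mathcal{A}^{-1})=\mathcal{A}^{-1}_0\otimes\mathcal{A}^{-1}_1$, and all displayed products are the ordinary products of $A$ and of $H$.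
   Context: Everything is over a field $\Bbbk$, $\otimes=\otimes_{\Bbbk}$, and Sweedler notation with suppressed summation is used. $H$ is a Hopf algebra with counit $\varepsilon$ and antipode $S$; $H^{\mathrm{op}}$ is $H$ with opposite multiplication. A right $H$-comodule algebra $(A,\rho_A)$ is a unital associative algebra $A$ which is a right $H$-comodule via an algebra map $\rho_A:A\to A\otimes H$, $\rho_A(a)=a_0\otimes a_1$ (iterated: $a_0\otimes a_1\otimes a_2$, etc.). With $\psi:H\otimes A\otimes H^{\mathrm{op}}\to A\otimes H^{\mathrm{op}}\otimes H$, $\psi(h\otimes a\otimes l)=a_0\otimes l_1\otimes l_2ha_1$, one has a cowreath $(A\otimes H^{\mathrm{op}},H,\psi)$. A left integral in $H$ is $\Lambda\in H$ with $h\Lambda=\varepsilon(h)\Lambda$ for all $h$; a right integral in $H^*$ is $\lambda\in H^*$ with $\lambda(h_1)h_2=\lambda(h)1_H$ for all $h$. The distinguished grouplike element of $H^*$ is the algebra map $\mu:H\to\Bbbk$ with $\Lambda h=\mu(h)\Lambda$ for all $h\in H$, for a nonzero left integral $\Lambda$. The antipode of a finite-dimensional Hopf algebra is bijective. Convention: whenever a multiplication symbol is omitted, products in $A\otimes H$ are computed with the ordinary multiplications of $A$ and of $H$ (not the opposite one). Elements of $A\otimes H$ are written $b\otimes u$, with sum understood. $C_{A\otimes H^{\mathrm{op}}}(coH):=\{b\otimes u\in A\otimes H^{\mathrm{op}}\mid ba_0\otimes S^{-1}(a_1)u=a_0b\otimes uS^{-1}(a_1)\text{ for every }a\in A\}$,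 a subalgebra of $A\otimes H^{\mathrm{op}}$; $(\cdot)^\times$ denotes its group of invertible elements (with inverses taken in the algebra $A\otimes H^{\mathrm{op}}$). A Casimir morphism for $(H,\psi)$ is a $\Bbbk$-linear map $B:H\otimes H\to A\otimes H^{\mathrm{op}}$, written $B(h\otimes h')=B^A(h\otimes h')\otimes B^H(h\otimes h')$, such that for all $a\in A$, $g,h,h'\in H$: $$(a_0\otimes 1_H)B(g_2ha_1\otimes g_3h'a_2)(1_A\otimes g_1)=(1_A\otimes g)B(h\otimes h')(a\otimes 1_H),$$ $$B^A(h_2\otimes h')_0\otimes B^H(h_2\otimes h')_1\otimes B^H(h_2\otimes h')_2h_1B^A(h_2\otimes h')_1=B(h\otimes h'_1)\otimes h'_2.$$ A Frobenius pair for the cowreath is a pair $(B,\mathfrak{t})$ consisting of a Casimir morphism $B$ and an element $\mathfrak{t}=\mathfrak{t}^1\otimes\mathfrak{t}^2\otimes\mathfrak{t}^3\in A\otimes H\otimes H$ such that for all $a\in A$, $h\in H$: $$a\mathfrak{t}^1\otimes\mathfrak{t}^2h\otimes\mathfrak{t}^3=\mathfrak{t}^1a_0\otimes h_1\mathfrak{t}^2\otimes h_2\mathfrak{t}^3a_1,$$ $$(\mathfrak{t}^1\otimes 1_H)B(\mathfrak{t}^3\otimes h)(1_A\otimes\mathfrak{t}^2)=\varepsilon(h)1_A\otimes 1_H=(\mathfrak{t}^1_0\otimes 1_H)B(\mathfrak{t}^2_2h\mathfrak{t}^1_1\otimes\mathfrak{t}^3)(1_A\otimes\mathfrak{t}^2_1).$$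 *)

(* Defs.v *)
From HB Require Import structures.
From mathcomp Require Import all_boot all_order all_algebra.
From mathcomp Require Import falgebra boolp.

Set Implicit Arguments.
Unset Strict Implicit.
Unset Printing Implicit Defensive.

Import GRing.Theory.
Local Open Scope ring_scope.
Local Open Scope quotient_scope.

Reserved Notation "x \ox y" (at level 45, right associativity).
Reserved Notation "'\sw_(' x '\ox' y '<-' t ')' e"
  (at level 46, x name, y name, t at level 99, e at level 46,
   format "'\sw_(' x  '\ox'  y  '<-'  t ')'  e").
Reserved Notation "'\sw_(' x '\ox' y '\ox' z '<-' t ')' e"
  (at level 46, x name, y name, z name, t at level 99, e at level 46,
   format "'\sw_(' x  '\ox'  y  '\ox'  z  '<-'  t ')'  e").
Reserved Notation "x *t y" (at level 40, left associativity).
Reserved Notation "x *o y" (at level 40, left associativity).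

(** The tensor product of two spaces is the quotient of the formal sums of pairs
   by the bilinearity relations.  Formal sums carry no coefficients: the scalar
   [c] of a term [c (v, w)] is absorbed in [(c *: v, w)]. *)

Section TensorEquiv.
Variables (k : fieldType) (V W : lmodType k).

Inductive tensor_eqv : seq (V * W) -> seq (V * W) -> Prop :=
| TEqvRefl s : tensor_eqv s s
| TEqvSym s t : tensor_eqv s t -> tensor_eqv t s
| TEqvTrans s t u : tensor_eqv s t -> tensor_eqv t u -> tensor_eqv s u
| TEqvCat s s' t t' :
    tensor_eqv s s' -> tensor_eqv t t' -> tensor_eqv (s ++ t) (s' ++ t')
| TEqvComm s t : tensor_eqv (s ++ t) (t ++ s)
| TEqvZero : tensor_eqv [:: (0, 0)] [::]
| TEqvAddl v v' w : tensor_eqv [:: (v + v', w)] [:: (v, w); (v', w)]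
| TEqvAddr v w w' : tensor_eqv [:: (v, w + w')] [:: (v, w); (v, w')]
| TEqvScale (c : k) v w : tensor_eqv [:: (c *: v, w)] [:: (v, c *: w)].

Definition tensor_eqvb : rel (seq (V * W)) := fun s t => `[< tensor_eqv s t >].

Lemma tensor_eqvb_refl : reflexive tensor_eqvb.
Proof. by move=> s; apply/asboolP; exact: TEqvRefl. Qed.

Lemma tensor_eqvb_sym : symmetric tensor_eqvb.
Proof. by move=> s t; apply/asboolP/asboolP; exact: TEqvSym. Qed.

Lemma tensor_eqvb_trans : transitive tensor_eqvb.
Proof.
by move=> t s u /asboolP st /asboolP tu; apply/asboolP; exact: TEqvTrans st tu.
Qed.

Canonical tensor_equiv :=
  EquivRel tensor_eqvb tensor_eqvb_refl tensor_eqvb_sym tensor_eqvb_trans.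

Definition tensor := {eq_quot tensor_equiv}.

HB.instance Definition _ := Choice.on tensor.
HB.instance Definition _ := Quotient.on tensor.

End TensorEquiv.

Arguments tensor {k} (V W)%_type_scope.
Notation "V \ox W" := (tensor V W) : type_scope.

Section TensorModule.
Variables (k : fieldType) (V W : lmodType k).
Implicit Types (s t : seq (V * W)) (x y z : V \ox W).

Lemma tensor_piP s t :
  reflect (tensor_eqv s t) (\pi_(V \ox W) s == \pi_(V \ox W) t).
Proof. by rewrite piE; exact: asboolP. Qed.

Lemma tensor_repr s : tensor_eqv (repr (\pi_(V \ox W) s)) s.
Proof. by apply/tensor_piP; rewrite reprK. Qed.

Definition tensor_zero : V \ox W := \pi_(V \ox W) [::].
Definition tensor_add x y : V \ox W := \pi_(V \ox W) (repr x ++ repr y).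
Definition tensor_scale (c : k) x : V \ox W :=
  \pi_(V \ox W) [seq (c *: p.1, p.2) | p <- repr x].
Definition tensor_opp x : V \ox W := tensor_scale (-1) x.

Definition pure_tensor (v : V) (w : W) : V \ox W := \pi_(V \ox W) [:: (v, w)].

Lemma tensor_add_pi s t :
  tensor_add (\pi s) (\pi t) = \pi_(V \ox W) (s ++ t).
Proof. by apply/eqP/tensor_piP; apply: TEqvCat; exact: tensor_repr. Qed.

Lemma tensor_eqv0l (w : W) : tensor_eqv [:: (0 : V, w)] [::].
Proof.
rewrite -[0 : V](scale0r 0); apply: TEqvTrans (TEqvScale _ _ _) _.
by rewrite scale0r; exact: TEqvZero.
Qed.

Lemma tensor_eqv_scale (c : k) s t : tensor_eqv s t ->
  tensor_eqv [seq (c *: p.1, p.2) | p <- s] [seq (c *: p.1, p.2) | p <- t].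
Proof.
elim=> {s t} [s|s t _|s t u _ + _|s s' t t' _ + _|s t||v v' w|v w w'|d v w] /=.
- exact: TEqvRefl.
- exact: TEqvSym.
- exact: TEqvTrans.
- by rewrite !map_cat; exact: TEqvCat.
- by rewrite !map_cat; exact: TEqvComm.
- by rewrite scaler0; exact: TEqvZero.
- by rewrite scalerDr; exact: TEqvAddl.
- exact: TEqvAddr.
- by rewrite scalerA mulrC -scalerA; exact: TEqvScale.
Qed.

Lemma tensor_scale_pi (c : k) s :
  tensor_scale c (\pi s) = \pi_(V \ox W) [seq (c *: p.1, p.2) | p <- s].
Proof. by apply/eqP/tensor_piP/tensor_eqv_scale; exact: tensor_repr. Qed.

Lemma tensor_addA : associative tensor_add.
Proof.
by elim/quotW=> s; elim/quotW=> t; elim/quotW=> u; rewrite !tensor_add_pi catA.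
Qed.

Lemma tensor_addC : commutative tensor_add.
Proof.
elim/quotW=> s; elim/quotW=> t; rewrite !tensor_add_pi.
by apply/eqP/tensor_piP; exact: TEqvComm.
Qed.

Lemma tensor_add0 : left_id tensor_zero tensor_add.
Proof. by elim/quotW=> s; rewrite tensor_add_pi. Qed.

Lemma tensor_scaleDl x c d :
  tensor_scale (c + d) x = tensor_add (tensor_scale c x) (tensor_scale d x).
Proof.
elim/quotW: x => s; rewrite !tensor_scale_pi tensor_add_pi.
apply/eqP/tensor_piP; elim: s => [|[v w] s IHs] /=; first exact: TEqvRefl.
rewrite scalerDl -cat1s; apply: TEqvTrans (TEqvCat (TEqvAddl _ _ _) IHs) _ => /=.
rewrite -cat1s -[X in tensor_eqv _ X]cat1s; apply: TEqvCat; first exact: TEqvRefl.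
set s1 := map _ s; set s2 := map _ s.
rewrite -[(d *: v, w) :: s1 ++ s2]/(([:: (d *: v, w)] ++ s1) ++ s2).
rewrite -[s1 ++ (d *: v, w) :: s2]/(s1 ++ [:: (d *: v, w)] ++ s2) catA.
by apply: TEqvCat (TEqvComm _ _) (TEqvRefl _).
Qed.

Lemma tensor_scale0 x : tensor_scale 0 x = tensor_zero.
Proof.
elim/quotW: x => s; rewrite tensor_scale_pi; apply/eqP/tensor_piP.
elim: s => [|[v w] s IHs] /=; first exact: TEqvRefl.
by rewrite scale0r -[[::]]cat0s -cat1s; apply: TEqvCat IHs; exact: tensor_eqv0l.
Qed.

Lemma tensor_scale1 : left_id 1 tensor_scale.
Proof.
elim/quotW=> s; rewrite tensor_scale_pi.
by congr \pi; rewrite -[RHS]map_id; apply: eq_map => -[v w]; rewrite /= scale1r.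
Qed.

Lemma tensor_addN : left_inverse tensor_zero tensor_opp tensor_add.
Proof.
move=> x; rewrite -{2}[x]tensor_scale1 -tensor_scaleDl addNr.
exact: tensor_scale0.
Qed.

HB.instance Definition _ := GRing.isZmodule.Build (V \ox W)
  tensor_addA tensor_addC tensor_add0 tensor_addN.

Lemma tensor_scaleA (c d : k) x :
  tensor_scale c (tensor_scale d x) = tensor_scale (c * d) x.
Proof.
elim/quotW: x => s; rewrite !tensor_scale_pi -map_comp.
by congr \pi; apply: eq_map => p /=; rewrite scalerA.
Qed.

Lemma tensor_scaleDr : right_distributive tensor_scale +%R.
Proof.
move=> c; elim/quotW=> s; elim/quotW=> t.
rewrite [_ + _ in LHS]tensor_add_pi !tensor_scale_pi map_cat.
by rewrite [RHS]tensor_add_pi.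
Qed.

HB.instance Definition _ := GRing.Zmodule_isLmodule.Build k (V \ox W)
  tensor_scaleA tensor_scale1 tensor_scaleDr tensor_scaleDl.

End TensorModule.

Notation "v \ox w" := (pure_tensor v w) : ring_scope.

(** [tsum t f] is the sum of the [f v w] over a decomposition of [t] into pure
   tensors.  For bilinear [f] it is the linear map induced by [f], applied to [t]
   (see [tsum_bilinear]); it is only meaningful for such [f]. *)

Definition tsum (k : fieldType) (V W : lmodType k) (U : nmodType)
    (t : V \ox W) (f : V -> W -> U) : U :=
  \sum_(p <- repr t) f p.1 p.2.

Notation "'\sw_(' x '\ox' y '<-' t ')' e" := (tsum t (fun x y => e)) : ring_scope.
Notation "'\sw_(' x '\ox' y '\ox' z '<-' t ')' e" :=
  (tsum t (fun x p => tsum p (fun y z => e))) : ring_scope.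

Section TensorUniversal.
Variables (k : fieldType) (V W U : lmodType k).

Lemma tensor_ind (P : V \ox W -> Prop) :
  P 0 -> (forall v w t, P t -> P (v \ox w + t)) -> forall t, P t.
Proof.
move=> P0 PD; elim/quotW; elim=> [//|[v w] s IHs].
suff -> : \pi_(V \ox W) ((v, w) :: s) = v \ox w + \pi s by exact: PD.
by rewrite [RHS]tensor_add_pi.
Qed.

Lemma pure_tensorDl (v v' : V) (w : W) : (v + v') \ox w = v \ox w + v' \ox w.
Proof.
by rewrite [RHS]tensor_add_pi; apply/eqP/tensor_piP; exact: TEqvAddl.
Qed.

Lemma pure_tensorDr (v : V) (w w' : W) : v \ox (w + w') = v \ox w + v \ox w'.
Proof.
by rewrite [RHS]tensor_add_pi; apply/eqP/tensor_piP; exact: TEqvAddr.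
Qed.

Lemma pure_tensorZl c (v : V) (w : W) : (c *: v) \ox w = c *: (v \ox w).
Proof. by rewrite [RHS]tensor_scale_pi. Qed.

Lemma pure_tensorZr c (v : V) (w : W) : v \ox (c *: w) = c *: (v \ox w).
Proof.
by rewrite -pure_tensorZl; apply/esym/eqP/tensor_piP; exact: TEqvScale.
Qed.

Lemma tsum_bilinear (f : V -> W -> U) : bilinear_for *:%R *:%R f ->
  linear (fun t => tsum t f) /\ (forall v w, tsum (v \ox w) f = f v w).
Proof.
move=> [fl fr].
have f0l w : f 0 w = 0.
  by have := fl w (-1) 0 0; rewrite /= !scaleN1r oppr0 addr0 addNr.
pose F (s : seq (V * W)) := \sum_(p <- s) f p.1 p.2.
have FE s t : tensor_eqv s t -> F s = F t.
  rewrite /F; elim=> {s t} [s|s t _|s t u _ + _|s s' t t' _ + _|s t||v v' w|v w w'|c v w] //.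
  - by move=> -> ->.
  - by rewrite !big_cat /= => -> ->.
  - by rewrite !big_cat /= addrC.
  - by rewrite big_seq1 big_nil /= f0l.
  - by rewrite !big_cons !big_nil !addr0 /=; have := fl w 1 v v'; rewrite /= !scale1r.
  - by rewrite !big_cons !big_nil !addr0 /=; have := fr v 1 w w'; rewrite /= !scale1r.
  - rewrite !big_seq1 /=; have := fl w c v 0; have := fr v c w 0.
    have f0r : f v 0 = 0.
      by have := fr v (-1) 0 0; rewrite /= !scaleN1r oppr0 addr0 addNr.
    by rewrite /= f0r f0l !addr0 => -> ->.
have tsum_pi s : tsum (\pi s) f = F s by exact/FE/tensor_repr.
split=> [c x y|v w]; last by rewrite tsum_pi /F big_seq1.
elim/quotW: x => s; elim/quotW: y => t.
rewrite /= [c *: _]tensor_scale_pi [_ + _]tensor_add_pi !tsum_pi /F big_cat big_map.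
congr (_ + _); rewrite scaler_sumr; apply: eq_bigr => -[v w] _ /=.
by have := fl w c v 0; rewrite /= f0l !addr0.
Qed.

End TensorUniversal.

Definition tensor_mul (k : fieldType) (V W : lmodType k)
    (x y : V \ox W) (mulV : V -> V -> V) (mulW : W -> W -> W) : V \ox W :=
  \sw_(v \ox w <- x) \sw_(v' \ox w' <- y) mulV v v' \ox mulW w w'.

(** An algebra is a ring [A] with a ring morphism from [k] to its centre.  This
   is used for comodule algebras instead of [algType k], which excludes the zero
   algebra. *)

Structure unitalAlgType (k : fieldType) := UnitalAlg {
  unital_ring : pzRingType;
  unital_map : {rmorphism k -> unital_ring};
  unital_map_central :
    forall (c : k) (x : unital_ring), unital_map c * x = x * unital_map c
}.

Definition unital_sort (k : fieldType) (A : unitalAlgType k) : Type :=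
  unital_ring A.
Coercion unital_sort : unitalAlgType >-> Sortclass.

Section UnitalAlgebraTheory.
Variables (k : fieldType) (A : unitalAlgType k).

HB.instance Definition _ := GRing.PzRing.on (unital_sort A).

Definition unital_scale (c : k) (x : A) : A := unital_map A c * x.

Lemma unital_scaleA c d x :
  unital_scale c (unital_scale d x) = unital_scale (c * d) x.
Proof. by rewrite /unital_scale rmorphM mulrA. Qed.

Lemma unital_scale1 : left_id 1 unital_scale.
Proof. by move=> x; rewrite /unital_scale rmorph1 mul1r. Qed.

Lemma unital_scaleDr : right_distributive unital_scale +%R.
Proof. by move=> c x y; rewrite /unital_scale mulrDr. Qed.

Lemma unital_scaleDl x : {morph unital_scale^~ x : c d / c + d}.
Proof. by move=> c d; rewrite /unital_scale rmorphD mulrDl. Qed.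

HB.instance Definition _ := GRing.Zmodule_isLmodule.Build k (unital_sort A)
  unital_scaleA unital_scale1 unital_scaleDr unital_scaleDl.

Lemma unital_scalerAl (c : k) (x y : A) : c *: (x * y) = (c *: x) * y.
Proof. exact: mulrA. Qed.

Lemma unital_scalerAr (c : k) (x y : A) : c *: (x * y) = x * (c *: y).
Proof.
transitivity (unital_map A c * (x : unital_ring A) * y); first exact: mulrA.
by rewrite unital_map_central -mulrA.
Qed.

End UnitalAlgebraTheory.

(** [x *t y] is the product of [A \ox B], [x *o y] that of [A \ox B^op]; the two
   algebras have the same underlying space, written [A \ox B] in both cases. *)
Notation "x *t y" := (tensor_mul x y *%R *%R) : ring_scope.
Notation "x *o y" := (tensor_mul x y *%R (fun u v => v * u)) : ring_scope.

Structure finHopfAlgType (k : fieldType) := FinHopfAlg {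
  hopf_alg :> falgType k;
  comul : {linear hopf_alg -> (hopf_alg \ox hopf_alg)%type};
  counit : {scalar hopf_alg};
  antipode : {linear hopf_alg -> hopf_alg};
  comulA : forall h : hopf_alg,
    \sw_(x \ox h3 <- comul h) \sw_(h1 \ox h2 <- comul x) h1 \ox h2 \ox h3 =
    \sw_(h1 \ox y <- comul h) \sw_(h2 \ox h3 <- comul y) h1 \ox h2 \ox h3;
  comul_counitl : forall h : hopf_alg,
    \sw_(h1 \ox h2 <- comul h) counit h1 *: h2 = h;
  comul_counitr : forall h : hopf_alg,
    \sw_(h1 \ox h2 <- comul h) counit h2 *: h1 = h;
  comul1 : comul 1 = 1 \ox 1;
  comulM : forall g h : hopf_alg, comul (g * h) = comul g *t comul h;
  counit1 : counit 1 = 1;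
  counitM : forall g h : hopf_alg, counit (g * h) = counit g * counit h;
  antipodel : forall h : hopf_alg,
    \sw_(h1 \ox h2 <- comul h) antipode h1 * h2 = counit h *: 1;
  antipoder : forall h : hopf_alg,
    \sw_(h1 \ox h2 <- comul h) h1 * antipode h2 = counit h *: 1
}.

Arguments comul {k _}.
Arguments counit {k _}.
Arguments antipode {k _}.

Structure comodAlgType (k : fieldType) (H : finHopfAlgType k) := ComodAlg {
  comod_alg :> unitalAlgType k;
  coact : {linear comod_alg -> (comod_alg \ox H)%type};
  coactA : forall a : comod_alg,
    \sw_(x \ox a2 <- coact a) \sw_(a0 \ox a1 <- coact x) a0 \ox a1 \ox a2 =
    \sw_(a0 \ox y <- coact a) \sw_(a1 \ox a2 <- comul y) a0 \ox a1 \ox a2;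
  coact_counit : forall a : comod_alg,
    \sw_(a0 \ox a1 <- coact a) counit a1 *: a0 = a;
  coact1 : coact 1 = (1 : comod_alg) \ox 1;
  coactM : forall a b : comod_alg, coact (a * b) = coact a *t coact b
}.

Arguments coact {k H _}.

Section HopfTheory.
Variables (k : fieldType) (H : finHopfAlgType k).
Implicit Types (h : H).

Definition comul2 h : H \ox (H \ox H) := \sw_(h1 \ox x <- comul h) h1 \ox comul x.

Definition left_integral (L : H) : Prop := forall h, h * L = counit h *: L.

Definition right_dual_integral (l : {scalar H}) : Prop :=
  forall h, \sw_(h1 \ox h2 <- comul h) l h1 *: h2 = l h *: 1.

(** Nonzero left integrals of a finite-dimensional Hopf algebra are unique up to
   a scalar, so that the choice of [L] is immaterial. *)
Definition distinguished_grouplike (m : {scalar H}) : Prop :=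
  monoid_morphism m /\
  exists L : H, [/\ L != 0, left_integral L & forall h, L * h = m h *: L].

End HopfTheory.

(** The antipode of a finite-dimensional Hopf algebra is bijective, hence the
   one-sided inverse below is its inverse. *)
Definition antipode_inv (k : fieldType) (H : finHopfAlgType k) : H -> H :=
  ((linfun (antipode : {linear H -> H}))^-1)%VF.

Section Cowreath.
Variables (k : fieldType) (H : finHopfAlgType k) (A : comodAlgType H).

Definition coact2 (a : A) : A \ox (H \ox H) :=
  \sw_(a0 \ox x <- coact a) a0 \ox comul x.

(** The structure map [H \ox (A \ox H^op) -> (A \ox H^op) \ox H] of the
   cowreath, as a bilinear map; its values are read in [A \ox (H \ox H)]. *)
Definition cowreath_psi (h : H) (x : A \ox H) : A \ox (H \ox H) :=
  \sw_(a \ox l <- x) \sw_(a0 \ox a1 <- coact a)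
    \sw_(l1 \ox l2 <- comul l) a0 \ox l1 \ox (l2 * h * a1).

(** [B] takes values in [A \ox H^op]; the products in the conditions below are
   nevertheless those of [A \ox H]. *)
Definition casimir (B : {linear (H \ox H)%type -> (A \ox H)%type}) : Prop :=
  (forall (a : A) (g h h' : H),
     \sw_(a0 \ox a1 \ox a2 <- coact2 a) \sw_(g1 \ox g2 \ox g3 <- comul2 g)
       (a0 \ox 1) *t B ((g2 * h * a1) \ox (g3 * h' * a2)) *t ((1 : A) \ox g1) =
     ((1 : A) \ox g) *t B (h \ox h') *t (a \ox 1)) /\
  (forall h h' : H,
     \sw_(h1 \ox h2 <- comul h) cowreath_psi h1 (B (h2 \ox h')) =
     \sw_(h'1 \ox h'2 <- comul h')
       \sw_(b \ox u <- B (h \ox h'1)) b \ox u \ox h'2).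

Definition frobenius_pair (B : {linear (H \ox H)%type -> (A \ox H)%type})
    (t : A \ox (H \ox H)) : Prop :=
  [/\ casimir B,
      forall (a : A) (h : H),
        \sw_(t1 \ox t2 \ox t3 <- t) (a * t1) \ox (t2 * h) \ox t3 =
        \sw_(t1 \ox t2 \ox t3 <- t) \sw_(a0 \ox a1 <- coact a)
          \sw_(h1 \ox h2 <- comul h)
            (t1 * a0) \ox (h1 * t2) \ox (h2 * t3 * a1),
      forall h : H,
        \sw_(t1 \ox t2 \ox t3 <- t)
          (t1 \ox 1) *t B (t3 \ox h) *t ((1 : A) \ox t2) =
        counit h *: ((1 : A) \ox 1)
    & forall h : H,
        \sw_(t1 \ox t2 \ox t3 <- t) \sw_(t10 \ox t11 <- coact t1)
          \sw_(t21 \ox t22 <- comul t2)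
            (t10 \ox 1) *t B ((t22 * h * t11) \ox t3) *t ((1 : A) \ox t21) =
        counit h *: ((1 : A) \ox 1)].

End Cowreath.

Section CoH.
Variables (k : fieldType) (H : finHopfAlgType k) (A : comodAlgType H).

Definition coH_centralizer (x : A \ox H) : Prop :=
  forall a : A,
    \sw_(b \ox u <- x) \sw_(a0 \ox a1 <- coact a)
      (b * a0) \ox (antipode_inv a1 * u) =
    \sw_(b \ox u <- x) \sw_(a0 \ox a1 <- coact a)
      (a0 * b) \ox (u * antipode_inv a1).

Definition op_inverse (x y : A \ox H) : Prop :=
  x *o y = (1 : A) \ox 1 /\ y *o x = (1 : A) \ox 1.

End CoH.

(* Main.v *)
(** A Frobenius pair for the cowreath says that the coring [E \ox H] over
   [E = A \ox H^op] is Frobenius.  If [(B, t)] and [(B', t')] are two Frobenius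
   pairs, then [phi = B(t' \ox -)] and [phibar = B'(t \ox -)] are [E]-bimodule maps
   that are inverse to each other for convolution, and [t' = phi(t_1) t_2],
   [B'(c \ox c') = B(c \ox phibar(c'_1) c'_2)]; conversely, any such [phi], [phibar]
   twist [(B, t)] into a Frobenius pair.  A bimodule map is determined by its
   value [b \ox u] at [1]: it is [h |-> b \ox h_2 u S^-1(h_1)].  The values at [1] are
   the elements of the centralizer of [coH], and convolution becomes the
   product of [E].  The reference pair is
   [B(h \ox h') = lambda(S(h cAinv_1) h') cAinv_0 \ox 1], [t = cA \ox 1 \ox Lambda].
   The antipode is injective, hence bijective, because
   [lambda(S(h) Lambda_1) Lambda_2 = h]. *)

Require Import Defs.
From mathcomp Require Import all_boot all_order all_algebra falgebra.
From mathcomp Require boolp.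

Set Implicit Arguments.
Unset Strict Implicit.
Unset Printing Implicit Defensive.

Import GRing.Theory.
Local Open Scope ring_scope.

(** * Linearity and Sweedler sums *)

Section Linear.
Variable k : fieldType.
Implicit Types U V W X Y : lmodType k.

(** A tensor is a class of formal sums and [tsum] evaluates one chosen representative, so it is the
    expected Sweedler sum only when its body is multilinear. Each use of an axiom of [H] or [A]
    inside a sum therefore carries a linearity condition; the tactic [lin] discharges these, and the
    axioms are put in a form paired with an arbitrary multilinear [F]. The comparison and the
    twisting of Frobenius pairs are arguments about a coring [E \ox C] given by an entwining of an
    algebra with a coalgebra, and are carried out at that level, where they are short chains of
    equalities in coring notation. The Hopf structure enters through the inverse antipode, which
    solves a bimodule map for its value at [1], and through the reference pair. There the obstacle
    is that [lambda(S(h) h')] alone is not compatible with the right action of [A]: moving [a]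
    cyclically through [lambda] applies the Nakayama automorphism, with a factor [mu(a_1)]. Moving
    [a] across the inverse of [cA] produces the same factor, and this is the origin of the coaction
    of that inverse in the formula for [B']. *)

Lemma linear_fun0 V W (f : V -> W) : linear f -> f 0 = 0.
Proof. by move=> lf; have := lf (-1) 0 0; rewrite !scaleN1r oppr0 addr0 addNr. Qed.

Lemma linear_funD V W (f : V -> W) : linear f -> {morph f : x y / x + y}.
Proof. by move=> lf x y; have := lf 1 x y; rewrite !scale1r. Qed.

Lemma linear_funZ V W (f : V -> W) c : linear f -> {morph f : x / c *: x}.
Proof.
by move=> lf x; have := lf c x 0; rewrite (linear_fun0 lf) !addr0.
Qed.

Lemma linear_fun_sum V W (f : V -> W) (I : Type) (r : seq I) (F : I -> V) :
  linear f -> f (\sum_(i <- r) F i) = \sum_(i <- r) f (F i).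
Proof.
by move=> lf; rewrite (big_morph f (linear_funD lf) (linear_fun0 lf)).
Qed.

Lemma linear_id V : linear (fun x : V => x).
Proof. by []. Qed.

Lemma linear_comp U V W (g : V -> W) (f : U -> V) :
  linear g -> linear f -> linear (fun x => g (f x)).
Proof. by move=> lg lf c x y; rewrite lf lg. Qed.

Lemma bilinear_linearl U V W X (op : V -> W -> X) (f : U -> V) (w : W) :
  bilinear_for *:%R *:%R op -> linear f -> linear (fun x => op (f x) w).
Proof. by case=> opl _ lf c x y; rewrite lf opl. Qed.

Lemma bilinear_linearr U V W X (op : V -> W -> X) (f : U -> W) (v : V) :
  bilinear_for *:%R *:%R op -> linear f -> linear (fun x => op v (f x)).
Proof. by case=> _ opr lf c x y; rewrite lf opr. Qed.

Lemma bilinear_applyr V W X (op : V -> W -> X) (v : V) :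
  bilinear_for *:%R *:%R op -> linear (op v).
Proof. by case. Qed.

Lemma linear_scalel U V (f : U -> k^o) (v : V) :
  linear f -> linear (fun x => f x *: v).
Proof. by move=> lf c x y; rewrite lf scalerDl scalerA. Qed.

Lemma linear_scaler U V (f : U -> V) (c : k) :
  linear f -> linear (fun x => c *: f x).
Proof. by move=> lf d x y; rewrite lf scalerDr !scalerA mulrC. Qed.

Lemma linear_pack V W (f : {linear V -> W}) : linear f.
Proof. exact: linearP. Qed.

Lemma linear_scalar V (f : {scalar V}) : linear (f : V -> k^o).
Proof. exact: linearP. Qed.

Lemma linear_scalar_comp U V (l : {scalar V}) (f : U -> V) :
  linear f -> linear (fun x => (l (f x) : k^o)).
Proof. exact: linear_comp (linear_scalar l). Qed.

Lemma pure_tensor_bilinear V W :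
  bilinear_for *:%R *:%R (@pure_tensor k V W).
Proof.
split=> [w|v] c x y /=; first by rewrite pure_tensorDl pure_tensorZl.
by rewrite pure_tensorDr pure_tensorZr.
Qed.

Lemma alg_mul_bilinear (B : algType k) :
  bilinear_for *:%R *:%R (@GRing.mul B : B -> B -> B).
Proof.
split=> [w|v] c x y /=; first by rewrite mulrDl scalerAl.
by rewrite mulrDr scalerAr.
Qed.

Lemma unital_mul_bilinear (B : unitalAlgType k) :
  bilinear_for *:%R *:%R (@GRing.mul B : B -> B -> B).
Proof.
split=> [w|v] c x y /=; first by rewrite mulrDl unital_scalerAl.
by rewrite mulrDr unital_scalerAr.
Qed.

Lemma tsum_linear V W U (f : V -> W -> U) : bilinear_for *:%R *:%R f ->
  linear (fun t : (V \ox W)%type => tsum t f).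
Proof. by case/tsum_bilinear. Qed.

(** The tensor is fixed, so the sum runs over one representative and linearity passes through it
    termwise. When the tensor varies, as in [tsum_linear], bilinearity of the body makes the choice
    of representative immaterial. *)
Lemma tsum_linear_body V W U X (t : (V \ox W)%type) (f : U -> V -> W -> X) :
  (forall v w, linear (fun x => f x v w)) -> linear (fun x => tsum t (f x)).
Proof.
move=> lf c x y; rewrite /tsum scaler_sumr -big_split.
by apply: eq_bigr => p _; exact: lf.
Qed.

Lemma tsum_pure V W U (f : V -> W -> U) v w :
  bilinear_for *:%R *:%R f -> tsum (v \ox w) f = f v w.
Proof. by case/tsum_bilinear. Qed.

Lemma linear_tsum V W U X (g : U -> X) (t : (V \ox W)%type) (f : V -> W -> U) :
  linear g -> g (tsum t f) = tsum t (fun v w => g (f v w)).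
Proof. exact: linear_fun_sum. Qed.

Lemma scaler_tsum V W U (t : (V \ox W)%type) (f : V -> W -> U) c :
  c *: tsum t f = tsum t (fun v w => c *: f v w).
Proof. exact: scaler_sumr. Qed.

Lemma bilinear_tsuml U X Y V W (op : U -> X -> Y) (t : (V \ox W)%type)
    (f : V -> W -> U) x : bilinear_for *:%R *:%R op ->
  op (tsum t f) x = tsum t (fun v w => op (f v w) x).
Proof. by case=> opl _; exact: (linear_tsum t f (opl x)). Qed.

Lemma bilinear_tsumr U X Y V W (op : U -> X -> Y) (t : (V \ox W)%type)
    (f : V -> W -> X) u : bilinear_for *:%R *:%R op ->
  op u (tsum t f) = tsum t (fun v w => op u (f v w)).
Proof. by case=> _ opr; exact: (linear_tsum t f (opr u)). Qed.

Lemma tsum_tsum V W U V' W' (t : (V' \ox W')%type) (g : V' -> W' -> (V \ox W)%type)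
    (f : V -> W -> U) : bilinear_for *:%R *:%R f ->
  tsum (tsum t g) f = tsum t (fun v w => tsum (g v w) f).
Proof. by move/tsum_linear => lf; exact: (linear_tsum t g lf). Qed.

Lemma eq_tsum V W (U : nmodType) (f g : V -> W -> U) (t : (V \ox W)%type) :
  (forall v w, f v w = g v w) -> tsum t f = tsum t g.
Proof. by move=> fg; apply: eq_bigr => p _; exact: fg. Qed.

Lemma tensor_linear_ext V W U (f g : (V \ox W)%type -> U) : linear f -> linear g ->
  (forall v w, f (v \ox w) = g (v \ox w)) -> forall t, f t = g t.
Proof.
move=> lf lg fg; elim/tensor_ind => [|v w t IH].
  by rewrite !linear_fun0.
by rewrite (linear_funD lf) (linear_funD lg) fg IH.
Qed.

Lemma tsum_id V W (t : (V \ox W)%type) : \sw_(v \ox w <- t) v \ox w = t.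
Proof.
have bp := pure_tensor_bilinear V W.
apply: (tensor_linear_ext (tsum_linear bp)) => // v w.
by rewrite tsum_pure.
Qed.

Lemma exchange_tsum (U : nmodType) V W V' W' (s : (V \ox W)%type)
    (t : (V' \ox W')%type) (f : V -> W -> V' -> W' -> U) :
  tsum s (fun v w => tsum t (f v w)) =
  tsum t (fun v' w' => tsum s (fun v w => f v w v' w')).
Proof. exact: exchange_big. Qed.

End Linear.

Definition trilinear (k : fieldType) (U V W X : lmodType k)
    (F : U -> V -> W -> X) : Prop :=
  [/\ forall v w, linear (fun u => F u v w), forall u w, linear (fun v => F u v w)
    & forall u v, linear (F u v)].

Lemma trilinear_linear1 (k : fieldType) (U V W X Y : lmodType k)
    (F : U -> V -> W -> X) (f : Y -> U) v w :
  trilinear F -> linear f -> linear (fun x => F (f x) v w).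
Proof. by case=> F1 _ _ lf; exact: (linear_comp (F1 v w) lf). Qed.

Lemma trilinear_linear2 (k : fieldType) (U V W X Y : lmodType k)
    (F : U -> V -> W -> X) u (f : Y -> V) w :
  trilinear F -> linear f -> linear (fun x => F u (f x) w).
Proof. by case=> _ F2 _ lf; exact: (linear_comp (F2 u w) lf). Qed.

Lemma trilinear_linear3 (k : fieldType) (U V W X Y : lmodType k)
    (F : U -> V -> W -> X) u v (f : Y -> W) :
  trilinear F -> linear f -> linear (fun x => F u v (f x)).
Proof. by case=> _ _ F3 lf; exact: (linear_comp (F3 u v) lf). Qed.

Lemma tsum3_pure (k : fieldType) (U V W X : lmodType k) (F : U -> V -> W -> X)
    u v w : trilinear F ->
  \sw_(x \ox y \ox z <- u \ox v \ox w) F x y z = F u v w.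
Proof.
case=> F1 F2 F3; rewrite tsum_pure; last first.
  split=> [p|x]; first by apply: tsum_linear_body => *; exact: F1.
  by apply: tsum_linear; split.
by rewrite tsum_pure //; split.
Qed.

Lemma tsum3_linear (k : fieldType) (U V W X : lmodType k) (F : U -> V -> W -> X) :
  trilinear F ->
  linear (fun t : (U \ox V \ox W)%type => \sw_(x \ox y \ox z <- t) F x y z).
Proof.
case=> F1 F2 F3; apply: tsum_linear; split=> [p|x].
  by apply: tsum_linear_body => *; exact: F1.
by apply: tsum_linear; split.
Qed.

(** * Linearity of Sweedler expressions by recursion on the term *)

Ltac lin_leaf := solve [assumption | apply linear_scalar | apply linear_pack
  | apply pure_tensor_bilinear | apply alg_mul_bilinear
  | apply unital_mul_bilinear | eauto 1].

(* The pattern [fun _ => ?c] also matches when [c] depends on the bound variable;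
   it is [constr:(c)] that fails in this case. *)
Ltac cst f := lazymatch f with fun _ => ?c => constr:(c) end.

Ltac lin_hook := fail.

(** At each node the bound variable may occur in one argument only; the alternatives of [first],
    guarded by [cst], find out which, and the recursion continues there. For a Sweedler sum the
    argument is either the tensor, whose body must then be bilinear, or the body. *)
Ltac lin := cbv beta;
  lazymatch goal with
  | |- forall _, _ => intro; lin
  | |- bilinear_for _ _ _ =>
      first [lin_leaf | split; [intro; lin | intro; lin]]
  | |- trilinear _ => first [lin_leaf | split; lin]
  | |- GRing.linear_for _ (fun x => x) => exact: linear_id
  | |- GRing.linear_for _ (fun x => tsum (@?t x) (@?f x)) =>
      first
      [ let s := cst t in
        refine (@tsum_linear_body _ _ _ _ _ s f _); do 2 intro; lin
      | let g := cst f in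
        refine (@linear_comp _ _ _ _ (fun s => tsum s g) t _ _);
        [apply: tsum_linear; lin | lin] ]
  | |- GRing.linear_for _ (fun x => @GRing.scale _ _ (@?c x) (@?f x)) =>
      first
      [ let d := cst c in refine (@linear_scaler _ _ _ f d _); lin
      | let v := cst f in refine (@linear_scalel _ _ _ c v _); lin ]
  | |- _ => first [lin_hook | lin_app]
  end
with lin_app :=
  lazymatch goal with
  | tF : trilinear ?F |- GRing.linear_for _ (fun x => ?F (@?f x) (@?g x) (@?h x)) =>
      first
      [ let v := cst g in let w := cst h in
        refine (@trilinear_linear1 _ _ _ _ _ _ F f v w tF _); lin
      | let u := cst f in let w := cst h in
        refine (@trilinear_linear2 _ _ _ _ _ _ F u g w tF _); lin
      | let u := cst f in let v := cst g in
        refine (@trilinear_linear3 _ _ _ _ _ _ F u v h tF _); lin ]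
  | |- GRing.linear_for _ (fun x => ?op (@?f x) (@?g x)) =>
      first
      [ let w := cst g in
        refine (@bilinear_linearl _ _ _ _ _ op f w _ _); [lin_leaf | lin]
      | let v := cst f in
        refine (@bilinear_linearr _ _ _ _ _ op g v _ _); [lin_leaf | lin]
      | lin_app1 ]
  | |- _ => lin_app1
  end
with lin_app1 :=
  lazymatch goal with
  | |- GRing.linear_for _ (fun x => ?g (@?f x)) =>
      first
      [ refine (@linear_comp _ _ _ _ g f _ _); [lin_leaf | lin]
      | refine (@linear_scalar_comp _ _ _ _ f _); lin
      | lin_leaf ]
  | |- _ => first [lin_leaf | apply bilinear_applyr; lin]
  end.

(** * Products on the tensor product of two algebras *)

Section TensorMul.
Variables (k : fieldType) (V W : lmodType k).
Variables (mulV : V -> V -> V) (mulW : W -> W -> W).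
Hypothesis mulV_bilinear : bilinear_for *:%R *:%R mulV.
Hypothesis mulW_bilinear : bilinear_for *:%R *:%R mulW.

Local Notation "x ** y" := (tensor_mul x y mulV mulW)
  (at level 40, left associativity).

(** The products of the factors are arbitrary bilinear maps, so that the products [*t] and [*o] are
    both instances. *)
Lemma tensor_mul_bilinear :
  bilinear_for *:%R *:%R (fun x y : (V \ox W)%type => x ** y).
Proof. by rewrite /tensor_mul; lin. Qed.

End TensorMul.

(** In [tensor_mul x y mV mW] the operands precede the two products, so the generic rule for binary
    operations, which looks at the last two arguments, does not see them. *)
Ltac lin_hook ::=
  lazymatch goal with
  | |- GRing.linear_for _ (fun x => tensor_mul (@?f x) (@?g x) ?mV ?mW) =>
      let op := constr:(fun y z => tensor_mul y z mV mW) in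
      first
      [ let w := cst g in refine (@bilinear_linearl _ _ _ _ _ op f w _ _);
        [apply tensor_mul_bilinear; lin | lin]
      | let v := cst f in refine (@bilinear_linearr _ _ _ _ _ op g v _ _);
        [apply tensor_mul_bilinear; lin | lin] ]
  end.

Section TensorMulTheory.
Variables (k : fieldType) (V W : lmodType k).
Variables (mulV : V -> V -> V) (mulW : W -> W -> W).
Hypothesis mulV_bilinear : bilinear_for *:%R *:%R mulV.
Hypothesis mulW_bilinear : bilinear_for *:%R *:%R mulW.

Local Notation "x ** y" := (tensor_mul x y mulV mulW)
  (at level 40, left associativity).

Lemma tensor_mul_pure v w v' w' :
  (v \ox w) ** (v' \ox w') = mulV v v' \ox mulW w w'.
Proof. by rewrite /tensor_mul tsum_pure ?tsum_pure //; lin. Qed.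

Lemma tensor_mulA : associative mulV -> associative mulW ->
  associative (fun x y : (V \ox W)%type => x ** y).
Proof.
move=> mVA mWA x y z.
apply: (tensor_linear_ext (f := fun x => x ** (y ** z))
  (g := fun x => (x ** y) ** z)); [by lin..|].
move=> v w; apply: (tensor_linear_ext (f := fun y => (v \ox w) ** (y ** z))
  (g := fun y => ((v \ox w) ** y) ** z)); [by lin..|].
move=> v' w'; apply: (tensor_linear_ext
  (f := fun z => (v \ox w) ** ((v' \ox w') ** z))
  (g := fun z => ((v \ox w) ** (v' \ox w')) ** z)); [by lin..|].
by move=> v'' w''; rewrite !tensor_mul_pure mVA mWA.
Qed.

Lemma tensor_mul1 (oneV : V) (oneW : W) :
  left_id oneV mulV -> left_id oneW mulW ->
  left_id (oneV \ox oneW) (fun x y : (V \ox W)%type => x ** y).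
Proof.
move=> mV mW x.
apply: (tensor_linear_ext (f := fun x => (oneV \ox oneW) ** x) (g := fun x => x));
  [by lin..|].
by move=> v w; rewrite tensor_mul_pure mV mW.
Qed.

Lemma tensor_mulr1 (oneV : V) (oneW : W) :
  right_id oneV mulV -> right_id oneW mulW ->
  right_id (oneV \ox oneW) (fun x y : (V \ox W)%type => x ** y).
Proof.
move=> mV mW x.
apply: (tensor_linear_ext (f := fun x => x ** (oneV \ox oneW)) (g := fun x => x));
  [by lin..|].
by move=> v w; rewrite tensor_mul_pure mV mW.
Qed.

End TensorMulTheory.

(** * Frobenius pairs of an entwining structure *)

Section Entwining.
Variables (k : fieldType) (C E : lmodType k).
Variables (Delta : {linear C -> (C \ox C)%type}) (eps : {scalar C}).
Variables (one : E) (m : E -> E -> E) (psi : C -> E -> (E \ox C)%type).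

Local Notation "x ** y" := (m x y) (at level 40, left associativity).

Hypothesis m_bilinear : bilinear_for *:%R *:%R m.
Hypothesis mA : forall x y z, x ** (y ** z) = x ** y ** z.
Hypothesis m1e : forall x, one ** x = x.
Hypothesis me1 : forall x, x ** one = x.
Hypothesis psi_bilinear : bilinear_for *:%R *:%R psi.

(** Pairing with a trilinear [F] gives a form that rewrites inside a larger Sweedler sum without
    reassociating tensor products; [psi_mul] and [psi_comul] have this form for the same reason. *)
Hypothesis coassoc : forall (U : lmodType k) (F : C -> C -> C -> U) h,
  trilinear F ->
  \sw_(x \ox h3 <- Delta h) \sw_(h1 \ox h2 <- Delta x) F h1 h2 h3 =
  \sw_(h1 \ox x <- Delta h) \sw_(h2 \ox h3 <- Delta x) F h1 h2 h3.
Hypothesis counitl : forall h, \sw_(h1 \ox h2 <- Delta h) eps h1 *: h2 = h.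
Hypothesis counitr : forall h, \sw_(h1 \ox h2 <- Delta h) eps h2 *: h1 = h.

(* [psi h e] is [e_psi \ox h^psi] in the usual notation for entwinings. *)
Hypothesis psi_mul : forall (U : lmodType k) (F : E -> C -> U) h x y,
  bilinear_for *:%R *:%R F ->
  tsum (psi h (x ** y)) F =
  \sw_(x' \ox g <- psi h x) \sw_(y' \ox g' <- psi g y) F (x' ** y') g'.
Hypothesis psi_one : forall h, psi h one = one \ox h.
Hypothesis psi_comul : forall (U : lmodType k) (F : E -> C -> C -> U) h e,
  trilinear F ->
  \sw_(x \ox g <- psi h e) \sw_(g1 \ox g2 <- Delta g) F x g1 g2 =
  \sw_(h1 \ox h2 <- Delta h) \sw_(x \ox g2 <- psi h2 e)
    \sw_(y \ox g1 <- psi h1 x) F y g1 g2.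

(** [phi] stands for the left [E]-linear map [x \ox h |-> x ** phi h] on the coring [E \ox C], whose
    right action is [(x \ox h) e = (x \ox 1) psi h e] in loose notation. Only right linearity
    remains as a condition. *)
Definition entw_bimodule_map (phi : C -> E) : Prop :=
  forall h e, phi h ** e = \sw_(x \ox g <- psi h e) x ** phi g.

(** [B] stands for its left [E]-linear extension to the tensor square of the coring over [E]. The
    clauses are right linearity and [c_1 B(c_2 \ox c') = B(c \ox c'_1) c'_2]. *)
Definition entw_casimir (B : C -> C -> E) : Prop :=
  (forall h h' e, B h h' ** e =
     \sw_(x \ox g' <- psi h' e) \sw_(y \ox g <- psi h x) y ** B g g') /\
  (forall h h', \sw_(h1 \ox h2 <- Delta h) psi h1 (B h2 h') =
     \sw_(h'1 \ox h'2 <- Delta h') B h h'1 \ox h'2).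

Definition entw_central (t : (E \ox C)%type) : Prop :=
  forall e, \sw_(t1 \ox t2 <- t) (e ** t1) \ox t2 =
    \sw_(t1 \ox t2 <- t) \sw_(x \ox g <- psi t2 e) (t1 ** x) \ox g.

(** In the coring: [t] commutes with [E], and [B(t \ox c) = eps(c) = B(c \ox t)]. *)
Definition entw_frobenius (B : C -> C -> E) (t : (E \ox C)%type) : Prop :=
  [/\ entw_casimir B, entw_central t,
      forall h, \sw_(t1 \ox t2 <- t) t1 ** B t2 h = eps h *: one
    & forall h, \sw_(t1 \ox t2 <- t) \sw_(x \ox g <- psi h t1) x ** B g t2 =
        eps h *: one].

Lemma entw_casimir_comul (B : C -> C -> E) (U : lmodType k) (F : E -> C -> U) h h' :
  bilinear_for *:%R *:%R F -> entw_casimir B ->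
  \sw_(h1 \ox h2 <- Delta h) tsum (psi h1 (B h2 h')) F =
  \sw_(h'1 \ox h'2 <- Delta h') F (B h h'1) h'2.
Proof.
move=> bF [_ CB]; rewrite -tsum_tsum // CB tsum_tsum //.
by apply: eq_tsum => x y; rewrite tsum_pure.
Qed.

Lemma entw_centralE (t : (E \ox C)%type) (U : lmodType k) (F : E -> C -> U) e :
  bilinear_for *:%R *:%R F -> entw_central t ->
  \sw_(t1 \ox t2 <- t) F (e ** t1) t2 =
  \sw_(t1 \ox t2 <- t) \sw_(x \ox g <- psi t2 e) F (t1 ** x) g.
Proof.
move=> bF ct; have := congr1 (fun s => tsum s F) (ct e).
rewrite !tsum_tsum //; under eq_tsum => x y do rewrite tsum_pure //.
move=> ->; apply: eq_tsum => x y; rewrite tsum_tsum //.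
by apply: eq_tsum => z w; rewrite tsum_pure.
Qed.

Local Notation m_suml := (bilinear_tsuml _ _ _ m_bilinear).
Local Notation m_sumr := (bilinear_tsumr _ _ _ m_bilinear).

Lemma counitlE (U : lmodType k) (G : C -> U) h : linear G ->
  \sw_(h1 \ox h2 <- Delta h) eps h1 *: G h2 = G h.
Proof.
move=> lG; rewrite -[in RHS](counitl h) (linear_tsum _ _ lG).
by apply: eq_tsum => x y; rewrite (linear_funZ _ lG).
Qed.

Lemma counitrE (U : lmodType k) (G : C -> U) h : linear G ->
  \sw_(h1 \ox h2 <- Delta h) eps h2 *: G h1 = G h.
Proof.
move=> lG; rewrite -[in RHS](counitr h) (linear_tsum _ _ lG).
by apply: eq_tsum => x y; rewrite (linear_funZ _ lG).
Qed.

(* [B(t \ox h)], with [B] extended to the coring [E \ox C]. *)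
Definition pair_casimir (B : C -> C -> E) (t : (E \ox C)%type) (h : C) : E :=
  \sw_(t1 \ox t2 <- t) t1 ** B t2 h.

Lemma pair_casimir_linear B t :
  bilinear_for *:%R *:%R B -> linear (pair_casimir B t).
Proof. by move=> bB; rewrite /pair_casimir; lin. Qed.

(** Writing [h e = x g] in the coring, [B(t \ox h) e = B(t \ox x g) = B(t x \ox g) = B(x t \ox g) =
    x B(t \ox g)]. *)
Lemma pair_casimir_bimodule B t : bilinear_for *:%R *:%R B ->
  entw_casimir B -> entw_central t -> entw_bimodule_map (pair_casimir B t).
Proof.
move=> bB CB ct h e; rewrite /pair_casimir.
transitivity (\sw_(t1 \ox t2 <- t) \sw_(x \ox g' <- psi h e)
    \sw_(y \ox g <- psi t2 x) t1 ** y ** B g g').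
  rewrite m_suml; apply: eq_tsum => t1 t2.
  rewrite -mA CB.1 m_sumr; apply: eq_tsum => x g'.
  by rewrite m_sumr; apply: eq_tsum => y g; rewrite mA.
rewrite exchange_tsum; apply: eq_tsum => x g'.
rewrite -(@entw_centralE t _ (fun u v => u ** B v g')) //; last by lin.
by rewrite m_sumr; apply: eq_tsum => y g; rewrite mA.
Qed.

(** Colinearity of [B] evaluated at [t]: [B(t \ox h_1) h_2 = t_1 B(t_2 \ox h)], with the coproduct
    of [t] in the coring. *)
Lemma pair_casimir_comul B t (U : lmodType k) (F : E -> C -> U) h :
  bilinear_for *:%R *:%R B -> bilinear_for *:%R *:%R F -> entw_casimir B ->
  \sw_(h1 \ox h2 <- Delta h) F (pair_casimir B t h1) h2 =
  \sw_(t1 \ox t2 <- t) \sw_(a \ox b <- Delta t2)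
    \sw_(x \ox g <- psi a (B b h)) F (t1 ** x) g.
Proof.
move=> bB bF CB.
under [RHS]eq_tsum => t1 t2.
  rewrite (@entw_casimir_comul _ _ (fun x g => F (t1 ** x) g)) //; last by lin.
  over.
rewrite exchange_tsum; apply: eq_tsum => h1 h2.
by rewrite (bilinear_tsuml _ _ _ bF).
Qed.

(* [c_1 B(c_2 \ox t) = c] for the generator [c = 1 \ox h] of the coring [E \ox C]. *)
Lemma frobenius_counit B t (U : lmodType k) (F : E -> C -> U) h :
  bilinear_for *:%R *:%R B -> bilinear_for *:%R *:%R F -> entw_frobenius B t ->
  \sw_(t1 \ox t2 <- t) \sw_(x \ox g <- psi h t1) \sw_(g1 \ox g2 <- Delta g)
    \sw_(u \ox v <- psi g1 (B g2 t2)) F (x ** u) v = F one h.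
Proof.
move=> bB bF [CB ct T2 T3].
transitivity (\sw_(h1 \ox h2 <- Delta h) \sw_(t1 \ox t2 <- t)
    \sw_(x \ox g2 <- psi h2 t1) tsum (psi h1 (x ** B g2 t2)) F).
  rewrite exchange_tsum; apply: eq_tsum => t1 t2.
  rewrite (@psi_comul _ (fun x g1 g2 => \sw_(u \ox v <- psi g1 (B g2 t2))
    F (x ** u) v)); last by lin.
  by apply: eq_tsum => h1 h2; apply: eq_tsum => x g2; rewrite psi_mul.
have lF h1 : linear (fun x => tsum (psi h1 x) F) by lin.
transitivity (\sw_(h1 \ox h2 <- Delta h) eps h2 *: F one h1).
  apply: eq_tsum => h1 h2.
  have := congr1 (fun x => tsum (psi h1 x) F) (T3 h2).
  rewrite /= (linear_funZ _ (lF h1)) psi_one tsum_pure // => <-.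
  rewrite (linear_tsum _ _ (lF h1)); apply: eq_tsum => t1 t2.
  by rewrite (linear_tsum _ _ (lF h1)).
by rewrite counitrE //; lin.
Qed.

(* [B(t' \ox t_1) t_2 = t'], paired with [F]. *)
Lemma pair_casimir_central B t t' (U : lmodType k) (F : E -> C -> U) :
  bilinear_for *:%R *:%R B -> bilinear_for *:%R *:%R F ->
  entw_frobenius B t -> entw_central t' ->
  \sw_(t1 \ox t2 <- t) \sw_(a \ox b <- Delta t2) F (t1 ** pair_casimir B t' a) b =
  tsum t' F.
Proof.
move=> bB bF fBt ct'; have [CB _ _ _] := fBt.
transitivity (\sw_(t1 \ox t2 <- t) \sw_(t'1 \ox t'2 <- t')
    \sw_(x \ox g <- psi t'2 t1) \sw_(g1 \ox g2 <- Delta g)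
      \sw_(u \ox v <- psi g1 (B g2 t2)) F (t'1 ** (x ** u)) v).
  apply: eq_tsum => t1 t2.
  rewrite (@pair_casimir_comul B t' _ (fun x b => F (t1 ** x) b)) //; last by lin.
  transitivity (\sw_(t'1 \ox t'2 <- t') \sw_(a \ox b <- Delta t'2)
      \sw_(x \ox g <- psi a (B b t2)) F ((t1 ** t'1) ** x) g).
    do 3 (apply: eq_tsum => ? ?); by rewrite mA.
  (* Centrality of [t'] carries the coefficient [t1] of [t] to the right of [t'], where
     [frobenius_counit] can contract [t] against [B]. *)
  rewrite (@entw_centralE t' _ (fun z c => \sw_(a \ox b <- Delta c)
    \sw_(x \ox g <- psi a (B b t2)) F (z ** x) g)) //; last by lin.
  do 4 (apply: eq_tsum => ? ?); by rewrite mA.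
rewrite exchange_tsum; apply: eq_tsum => t'1 t'2.
rewrite (@frobenius_counit B t _ (fun y v => F (t'1 ** y) v)) //; last by lin.
by rewrite me1.
Qed.

(** Let [phi = pair_casimir B t']. Colinearity of [B'] and right linearity of [phi] turn the left
    side into [B'(phi(t_1) t_2 \ox h)]; since [phi(t_1) t_2 = t'], this is [B'(t' \ox h)].
    Exchanging the two pairs gives the other convolution product. *)
Lemma pair_casimir_convolution B t B' t' h :
  bilinear_for *:%R *:%R B -> bilinear_for *:%R *:%R B' ->
  entw_frobenius B t -> entw_frobenius B' t' ->
  \sw_(h1 \ox h2 <- Delta h) pair_casimir B' t h1 ** pair_casimir B t' h2 =
  eps h *: one.
Proof.
move=> bB bB' fBt fBt'; have [CB _ _ _] := fBt; have [CB' ct' <- _] := fBt'.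
have lp := pair_casimir_linear t' bB.
rewrite (@pair_casimir_comul B' t _ (fun x g => x ** pair_casimir B t' g)) //;
  last by lin.
rewrite -(@pair_casimir_central B t t' _ (fun x g => x ** B' g h)) //; last by lin.
do 2 (apply: eq_tsum => ? ?).
rewrite -mA pair_casimir_bimodule // m_sumr.
by apply: eq_tsum => x g; rewrite mA.
Qed.

(* [B(h \ox phi(h'_1) h'_2)], where [psi] moves [phi(h'_1)] to the left of [h]. *)
Definition twist_casimir (phi : C -> E) (B : C -> C -> E) (h h' : C) : E :=
  \sw_(a \ox b <- Delta h') \sw_(x \ox g <- psi h (phi a)) x ** B g b.

Definition twist_central (phi : C -> E) (t : (E \ox C)%type) : (E \ox C)%type :=
  \sw_(t1 \ox t2 <- t) \sw_(a \ox b <- Delta t2) (t1 ** phi a) \ox b.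

(** [B'(h \ox h') = B'(h_1 B(h_2 \ox t) \ox h') = B(h \ox t_1) B'(t_2 \ox h') = B(h \ox t_1 B'(t_2
    \ox h')) = B(h \ox B'(t \ox h'_1) h'_2)]. The steps are the counit condition on [(B, t)],
    colinearity of [B], right linearity of [B], colinearity of [B']. *)
Lemma twist_casimir_pair B t B' t' h h' :
  bilinear_for *:%R *:%R B -> bilinear_for *:%R *:%R B' ->
  entw_frobenius B t -> entw_frobenius B' t' ->
  B' h h' = twist_casimir (pair_casimir B' t) B h h'.
Proof.
move=> bB bB' fBt fBt'; have [CB _ _ _] := fBt; have [CB' _ _ _] := fBt'.
rewrite /twist_casimir (@pair_casimir_comul B' t _ (fun u v =>
   \sw_(x \ox g <- psi h u) x ** B g v)) //; last by lin.
transitivity (\sw_(t1 \ox t2 <- t) \sw_(x \ox g <- psi h t1)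
    \sw_(a \ox b <- Delta t2) x ** B g a ** B' b h').
  transitivity (\sw_(t1 \ox t2 <- t) \sw_(x \ox g <- psi h t1)
      \sw_(g1 \ox g2 <- Delta g) \sw_(u \ox v <- psi g1 (B g2 t2))
        x ** u ** B' v h').
    by rewrite (@frobenius_counit B t _ (fun x v => x ** B' v h')) //; lin.
  apply: eq_tsum => t1 t2; apply: eq_tsum => x g.
  by rewrite (@entw_casimir_comul B _ (fun u v => x ** u ** B' v h')) //; lin.
apply: eq_tsum => t1 t2; rewrite exchange_tsum; apply: eq_tsum => a b.
transitivity (\sw_(x \ox g <- psi h t1) \sw_(y \ox c <- psi a (B' b h'))
   \sw_(z \ox g' <- psi g y) x ** z ** B g' c).
  apply: eq_tsum => x g; rewrite -mA CB.1 m_sumr; apply: eq_tsum => y c.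
  by rewrite m_sumr; apply: eq_tsum => z g'; rewrite mA.
rewrite exchange_tsum; apply: eq_tsum => y c.
by rewrite (@psi_mul _ (fun z d => z ** B d c)) //; lin.
Qed.

Lemma twist_central_pair B t t' : bilinear_for *:%R *:%R B ->
  entw_frobenius B t -> entw_central t' ->
  t' = twist_central (pair_casimir B t') t.
Proof.
move=> bB fBt ct'; rewrite -[LHS]tsum_id -(pair_casimir_central bB _ fBt ct') //.
by lin.
Qed.

(** * Twisting a Frobenius pair by a convolution-invertible bimodule map *)

Section Twist.
Variables (B : C -> C -> E) (t : (E \ox C)%type) (phi phibar : C -> E).
Hypothesis B_bilinear : bilinear_for *:%R *:%R B.
Hypothesis B_frobenius : entw_frobenius B t.
Hypotheses (phi_linear : linear phi) (phibar_linear : linear phibar).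
Hypothesis phi_bimodule : entw_bimodule_map phi.
Hypothesis phibar_bimodule : entw_bimodule_map phibar.
Hypothesis phi_phibar : forall h,
  \sw_(h1 \ox h2 <- Delta h) phi h1 ** phibar h2 = eps h *: one.
Hypothesis phibar_phi : forall h,
  \sw_(h1 \ox h2 <- Delta h) phibar h1 ** phi h2 = eps h *: one.

Local Notation B' := (twist_casimir phibar B).
Local Notation t' := (twist_central phi t).

Lemma tsum_twist_central (U : lmodType k) (F : E -> C -> U) :
  bilinear_for *:%R *:%R F ->
  tsum t' F = \sw_(t1 \ox t2 <- t) \sw_(a \ox b <- Delta t2) F (t1 ** phi a) b.
Proof.
move=> bF; rewrite /twist_central tsum_tsum //; apply: eq_tsum => t1 t2.
by rewrite tsum_tsum //; apply: eq_tsum => a b; rewrite tsum_pure.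
Qed.

(** The map [c |-> phi(c_1) c_2] is [E]-bilinear, so it sends the central element [t] to a central
    element. *)
Lemma twist_centralP : entw_central t'.
Proof.
move=> e; have [_ ct _ _] := B_frobenius.
rewrite !tsum_twist_central; [|by lin..].
transitivity (\sw_(t1 \ox t2 <- t) \sw_(x \ox g <- psi t2 e)
    \sw_(c \ox d <- Delta g) (t1 ** x ** phi c) \ox d).
  rewrite -(@entw_centralE t _ (fun x g => \sw_(c \ox d <- Delta g)
     (x ** phi c) \ox d)) //; last by lin.
  by do 2 (apply: eq_tsum => ? ?); rewrite mA.
apply: eq_tsum => t1 t2.
rewrite (@psi_comul _ (fun x c d => (t1 ** x ** phi c) \ox d)); last by lin.
apply: eq_tsum => a b; apply: eq_tsum => x g.
rewrite -mA phi_bimodule m_sumr.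
rewrite (bilinear_tsuml _ _ _ (pure_tensor_bilinear _ _)).
by apply: eq_tsum => y c; rewrite mA.
Qed.

(** The map [f(c) = phibar(c_1) c_2] is [E]-bilinear and right colinear, so [B(c \ox f(c'))]
    inherits both clauses from [B]; the second also uses coassociativity in the last argument. *)
Lemma twist_casimirP : entw_casimir B'.
Proof.
have [CB _ _ _] := B_frobenius; split=> [h h' e|h h'].
  transitivity (\sw_(a \ox b <- Delta h') \sw_(y \ox b' <- psi b e)
      \sw_(x \ox g' <- psi h (phibar a ** y)) x ** B g' b').
    rewrite m_suml; apply: eq_tsum => a b.
    transitivity (\sw_(x \ox g <- psi h (phibar a)) \sw_(y \ox b' <- psi b e)
      \sw_(z \ox g' <- psi g y) x ** z ** B g' b').
      rewrite m_suml; apply: eq_tsum => x g; rewrite -mA CB.1 m_sumr.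
      apply: eq_tsum => y b'; rewrite m_sumr.
      by apply: eq_tsum => z g'; rewrite mA.
    rewrite exchange_tsum; apply: eq_tsum => y b'.
    by rewrite (@psi_mul _ (fun x g' => x ** B g' b')) //; lin.
  transitivity (\sw_(y \ox b <- psi h' e) \sw_(c \ox b' <- Delta b)
      \sw_(x \ox g <- psi h (y ** phibar c)) x ** B g b').
    rewrite (@psi_comul _ (fun y c b' => \sw_(x \ox g <- psi h (y ** phibar c))
      x ** B g b')); last by lin.
    apply: eq_tsum => a b; apply: eq_tsum => y b'.
    rewrite phibar_bimodule (bilinear_tsumr _ _ _ psi_bilinear).
    by rewrite tsum_tsum //; lin.
  apply: eq_tsum => y b.
  under [RHS]eq_tsum => x g do rewrite m_sumr.
  rewrite [RHS]exchange_tsum; apply: eq_tsum => c b'.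
  rewrite (@psi_mul _ (fun x g => x ** B g b')); last by lin.
  apply: eq_tsum => x g; rewrite m_sumr.
  by apply: eq_tsum => z g'; rewrite mA.
transitivity (\sw_(a \ox b <- Delta h') \sw_(h1 \ox h2 <- Delta h)
    \sw_(x \ox g <- psi h2 (phibar a)) \sw_(y \ox g1 <- psi h1 x)
      \sw_(u \ox v <- psi g1 (B g b)) (y ** u) \ox v).
  rewrite exchange_tsum; apply: eq_tsum => h1 h2.
  rewrite (bilinear_tsumr _ _ _ psi_bilinear); apply: eq_tsum => a b.
  rewrite (bilinear_tsumr _ _ _ psi_bilinear); apply: eq_tsum => x g.
  by rewrite -[LHS]tsum_id psi_mul //; lin.
transitivity (\sw_(a \ox b <- Delta h') \sw_(b1 \ox b2 <- Delta b)
    \sw_(x \ox g <- psi h (phibar a)) (x ** B g b1) \ox b2).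
  apply: eq_tsum => a b; rewrite exchange_tsum.
  rewrite -(@psi_comul _ (fun y g1 g => \sw_(u \ox v <- psi g1 (B g b))
     (y ** u) \ox v)); last by lin.
  apply: eq_tsum => x g.
  by rewrite (@entw_casimir_comul B _ (fun u v => (x ** u) \ox v)) //; lin.
rewrite -(@coassoc _ (fun a b1 b2 => \sw_(x \ox g <- psi h (phibar a))
  (x ** B g b1) \ox b2)); last by lin.
apply: eq_tsum => p b2.
rewrite (bilinear_tsuml _ _ _ (pure_tensor_bilinear _ _)).
apply: eq_tsum => a b1.
by rewrite (bilinear_tsuml _ _ _ (pure_tensor_bilinear _ _)).
Qed.

(** Centrality of [t] pulls [phibar(h_1)] out to the left. What remains is [phi(t_1) B(t_2 \ox d) =
    phi(t_1 B(t_2 \ox d)) = B(t \ox d_1) phi(d_2) = phi(d)] with [d = h_2], and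
    [phibar(h_1) phi(h_2)] is the counit. *)
Lemma twist_counitl h : \sw_(t1 \ox t2 <- t') t1 ** B' t2 h = eps h *: one.
Proof.
have [CB ct T2 _] := B_frobenius.
have bB' : bilinear_for *:%R *:%R B' by rewrite /twist_casimir; lin.
rewrite tsum_twist_central; last by lin.
transitivity (\sw_(c \ox d <- Delta h) \sw_(t1 \ox t2 <- t)
    \sw_(x \ox g <- psi t2 (phibar c)) \sw_(a \ox b <- Delta g)
      t1 ** x ** phi a ** B b d).
  rewrite exchange_tsum; apply: eq_tsum => t1 t2.
  transitivity (\sw_(a \ox b <- Delta t2) \sw_(c \ox d <- Delta h)
    \sw_(x \ox g <- psi b (phibar c)) \sw_(y \ox a' <- psi a x)
      t1 ** y ** phi a' ** B g d).
    apply: eq_tsum => a b; rewrite m_sumr; apply: eq_tsum => c d.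
    rewrite m_sumr; apply: eq_tsum => x g.
    rewrite mA -[_ ** x]mA phi_bimodule m_sumr m_suml.
    by apply: eq_tsum => y a'; rewrite !mA.
  rewrite exchange_tsum; apply: eq_tsum => c d.
  by rewrite (@psi_comul _ (fun x a b => t1 ** x ** phi a ** B b d)) //; lin.
rewrite -phibar_phi; apply: eq_tsum => c d.
rewrite -(@entw_centralE t _ (fun x g => \sw_(a \ox b <- Delta g)
  x ** phi a ** B b d)) //; last by lin.
transitivity (\sw_(d1 \ox d2 <- Delta d)
   phibar c ** (pair_casimir B t d1 ** phi d2)).
  rewrite (@pair_casimir_comul B t _ (fun x g => phibar c ** (x ** phi g))) //;
    last by lin.
  apply: eq_tsum => t1 t2; apply: eq_tsum => a b.
  rewrite -!mA phi_bimodule !m_sumr.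
  by apply: eq_tsum => x g; rewrite !mA.
rewrite -m_sumr; congr (_ ** _); rewrite -[RHS]counitlE //.
apply: eq_tsum => d1 d2; rewrite /pair_casimir T2.
by rewrite (linear_funZ _ (m_bilinear.1 _)) m1e.
Qed.

(** Here the other convolution identity acts: [B(h \ox phi(t_1) phibar(t_2) t_3)] collapses to
    [B(h \ox t)]. *)
Lemma twist_counitr h :
  \sw_(t1 \ox t2 <- t') \sw_(x \ox g <- psi h t1) x ** B' g t2 = eps h *: one.
Proof.
have [_ _ _ T3] := B_frobenius.
have bB' : bilinear_for *:%R *:%R B' by rewrite /twist_casimir; lin.
rewrite tsum_twist_central; last by lin.
rewrite -T3; apply: eq_tsum => t1 t2.
transitivity (\sw_(a \ox b <- Delta t2) \sw_(c \ox d <- Delta b)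
    \sw_(x \ox g <- psi h (t1 ** (phi a ** phibar c))) x ** B g d).
  apply: eq_tsum => a b.
  under eq_tsum => x g do rewrite m_sumr.
  rewrite exchange_tsum; apply: eq_tsum => c d.
  rewrite mA (@psi_mul _ (fun x g => x ** B g d)); last by lin.
  apply: eq_tsum => x g; rewrite m_sumr.
  by apply: eq_tsum => y g'; rewrite mA.
rewrite -(@coassoc _ (fun a c d => \sw_(x \ox g <- psi h (t1 ** (phi a ** phibar c)))
   x ** B g d)); last by lin.
have lG d : linear (fun y => \sw_(x \ox g <- psi h (t1 ** y)) x ** B g d) by lin.
transitivity (\sw_(p \ox d <- Delta t2)
   eps p *: \sw_(x \ox g <- psi h t1) x ** B g d).
  apply: eq_tsum => p d.
  rewrite -(linear_tsum _ _ (lG d)) phi_phibar.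
  by rewrite (linear_funZ _ (lG d)) me1.
by rewrite counitlE //; lin.
Qed.

Lemma twist_frobenius : entw_frobenius B' t'.
Proof.
split; [exact: twist_casimirP | exact: twist_centralP | exact: twist_counitl |].
exact: twist_counitr.
Qed.

End Twist.

End Entwining.

(** * Finite-dimensional Hopf algebras and their integrals *)

Section Hopf.
Variables (k : fieldType) (H : finHopfAlgType k).
Implicit Types (g h : H) (U : lmodType k).
Local Notation S := (@antipode k H).

Lemma comul_coassoc U (F : H -> H -> H -> U) h : trilinear F ->
  \sw_(x \ox h3 <- comul h) \sw_(h1 \ox h2 <- comul x) F h1 h2 h3 =
  \sw_(h1 \ox x <- comul h) \sw_(h2 \ox h3 <- comul x) F h1 h2 h3.
Proof.
move=> tF; have lF := tsum3_linear tF.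
have := congr1 (fun t => \sw_(x \ox y \ox z <- t) F x y z) (comulA h).
rewrite /= !(linear_tsum _ _ lF) => e.
transitivity (\sw_(x \ox h3 <- comul h) \sw_(y \ox z \ox w <-
    \sw_(h1 \ox h2 <- comul x) h1 \ox h2 \ox h3) F y z w).
  apply: eq_tsum => x h3; rewrite (linear_tsum _ _ lF).
  by apply: eq_tsum => h1 h2; rewrite tsum3_pure.
rewrite e; apply: eq_tsum => h1 x; rewrite (linear_tsum _ _ lF).
by apply: eq_tsum => h2 h3; rewrite tsum3_pure.
Qed.

Lemma comul_counitlE U (G : H -> U) h : linear G ->
  \sw_(h1 \ox h2 <- comul h) counit h1 *: G h2 = G h.
Proof.
move=> lG; rewrite -[in RHS](comul_counitl h) (linear_tsum _ _ lG).
by apply: eq_tsum => x y; rewrite (linear_funZ _ lG).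
Qed.

Lemma comul_counitrE U (G : H -> U) h : linear G ->
  \sw_(h1 \ox h2 <- comul h) counit h2 *: G h1 = G h.
Proof.
move=> lG; rewrite -[in RHS](comul_counitr h) (linear_tsum _ _ lG).
by apply: eq_tsum => x y; rewrite (linear_funZ _ lG).
Qed.

Lemma tsum_comulM U (F : H -> H -> U) g h : bilinear_for *:%R *:%R F ->
  tsum (comul (g * h)) F =
  \sw_(g1 \ox g2 <- comul g) \sw_(h1 \ox h2 <- comul h) F (g1 * h1) (g2 * h2).
Proof.
move=> bF; rewrite comulM /tensor_mul tsum_tsum //; apply: eq_tsum => g1 g2.
by rewrite tsum_tsum //; apply: eq_tsum => h1 h2; rewrite tsum_pure.
Qed.

Lemma tsum_comul1 U (F : H -> H -> U) : bilinear_for *:%R *:%R F ->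
  tsum (comul (1 : H)) F = F 1 1.
Proof. by move=> bF; rewrite comul1 tsum_pure. Qed.

Lemma tsum_antipodel U (G : H -> U) h : linear G ->
  \sw_(h1 \ox h2 <- comul h) G (S h1 * h2) = counit h *: G 1.
Proof.
by move=> lG; rewrite -(linear_funZ _ lG) -antipodel (linear_tsum _ _ lG).
Qed.

Lemma tsum_antipoder U (G : H -> U) h : linear G ->
  \sw_(h1 \ox h2 <- comul h) G (h1 * S h2) = counit h *: G 1.
Proof.
by move=> lG; rewrite -(linear_funZ _ lG) -antipoder (linear_tsum _ _ lG).
Qed.

Lemma antipode1 : S 1 = 1.
Proof.
have := antipodel (1 : H); rewrite tsum_comul1; last by lin.
by rewrite mulr1 counit1 scale1r.
Qed.

Lemma counit_antipode h : counit (S h) = counit h.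
Proof.
have := congr1 (counit : H -> k^o) (antipodel h).
rewrite linearZ /= counit1 [RHS]mulr1 => <-.
rewrite (linear_tsum _ _ (linear_scalar (@counit k H))).
have lG : linear (fun h => (counit (S h) : k^o)) by lin.
rewrite -[LHS](comul_counitrE h lG).
by apply: eq_tsum => h1 h2; rewrite counitM [LHS]mulrC.
Qed.

(** Uniqueness of convolution inverses: the sum [X] of [S(g_1 h_1) g_2 h_2 S(h_3) S(g_3)] collapses
    to one side from the right and to the other from the left. *)
Lemma antipodeM g h : S (g * h) = S h * S g.
Proof.
pose X := \sw_(g1 \ox x <- comul g) \sw_(g2 \ox g3 <- comul x)
  \sw_(h1 \ox y <- comul h) \sw_(h2 \ox h3 <- comul y)
    S (g1 * h1) * (g2 * (h2 * S h3) * S g3).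
transitivity X.
  rewrite -[LHS](comul_counitrE (G := fun g => S (g * h))); last by lin.
  apply: eq_tsum => g1 x.
  rewrite -[S (g1 * h)]mulr1 -(@tsum_antipoder _ (fun y => S (g1 * h) * y));
    last by lin.
  apply: eq_tsum => g2 g3.
  rewrite -[LHS](comul_counitrE (G := fun h => S (g1 * h) * (g2 * S g3))); last by lin.
  apply: eq_tsum => h1 y.
  rewrite (@tsum_antipoder _ (fun z => S (g1 * h1) * (g2 * z * S g3))); last by lin.
  by rewrite mulr1.
rewrite /X -(@comul_coassoc _ (fun g1 g2 g3 => \sw_(h1 \ox y <- comul h)
  \sw_(h2 \ox h3 <- comul y) S (g1 * h1) * (g2 * (h2 * S h3) * S g3))); last by lin.
rewrite -[RHS](comul_counitlE (G := fun g => S h * S g)); last by lin.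
apply: eq_tsum => x g3.
transitivity (\sw_(y \ox h3 <- comul h) \sw_(z1 \ox z2 <- comul (x * y))
  S z1 * z2 * (S h3 * S g3)).
  under eq_tsum => g1 g2.
    rewrite -(@comul_coassoc _ (fun h1 h2 h3 =>
       S (g1 * h1) * (g2 * (h2 * S h3) * S g3))); last by lin.
    over.
  rewrite exchange_tsum; apply: eq_tsum => y h3.
  rewrite tsum_comulM; last by lin.
  by do 2 (apply: eq_tsum => ? ?); rewrite !mulrA.
rewrite -[RHS](comul_counitlE (G := fun h => counit x *: (S h * S g3))); last by lin.
apply: eq_tsum => y h3.
rewrite (@tsum_antipodel _ (fun z => z * (S h3 * S g3))); last by lin.
by rewrite mul1r counitM scalerA mulrC.
Qed.

Lemma tensor_hopf1l (x : (H \ox H)%type) : (1 \ox 1) *t x = x.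
Proof.
apply: tensor_mul1; [exact: alg_mul_bilinear | exact: alg_mul_bilinear | |];
  exact: mul1r.
Qed.

Lemma tensor_hopf1r (x : (H \ox H)%type) : x *t (1 \ox 1) = x.
Proof.
apply: tensor_mulr1; [exact: alg_mul_bilinear | exact: alg_mul_bilinear | |];
  exact: mulr1.
Qed.

Lemma tensor_hopfA (x y z : (H \ox H)%type) : x *t (y *t z) = x *t y *t z.
Proof.
apply: tensor_mulA; [exact: alg_mul_bilinear | exact: alg_mul_bilinear | |];
  exact: mulrA.
Qed.

(** Both sides are convolution inverses of [comul] with values in [H \ox H]; [ER] is this property
    for the right side. *)
Lemma comul_antipode h :
  comul (S h) = \sw_(h1 \ox h2 <- comul h) S h2 \ox S h1.
Proof.
pose R y := \sw_(y1 \ox y2 <- comul y) S y2 \ox S y1.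
have lR : linear R by rewrite /R; lin.
have bm : bilinear_for *:%R *:%R (fun x y : (H \ox H)%type => x *t y).
  by apply: tensor_mul_bilinear; lin.
have ER x : \sw_(a \ox y <- comul x) comul a *t R y = counit x *: (1 \ox 1).
  transitivity (\sw_(a \ox z <- comul x) \sw_(b \ox y <- comul z)
      \sw_(c \ox d <- comul y) (a * S d) \ox (b * S c)).
    rewrite -(@comul_coassoc _ (fun a b y => \sw_(c \ox d <- comul y)
      (a * S d) \ox (b * S c))); last by lin.
    apply: eq_tsum => a y; rewrite -[comul a in LHS]tsum_id.
    rewrite (bilinear_tsuml _ _ _ bm); apply: eq_tsum => b c.
    rewrite (bilinear_tsumr _ _ _ bm); apply: eq_tsum => d e.
    by rewrite tensor_mul_pure //; lin.
  transitivity (\sw_(a \ox z <- comul x) (a * S z) \ox (1 : H)).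
    apply: eq_tsum => a z.
    rewrite -(@comul_coassoc _ (fun b c d => (a * S d) \ox (b * S c)));
      last by lin.
    rewrite -[RHS](comul_counitlE (G := fun z => (a * S z) \ox (1 : H)));
      last by lin.
    apply: eq_tsum => w d.
    by rewrite (@tsum_antipoder _ (fun z => (a * S d) \ox z)) //; lin.
  by rewrite (@tsum_antipoder _ (fun z => z \ox (1 : H))) //; lin.
transitivity (\sw_(h1 \ox x <- comul h) \sw_(h2 \ox y <- comul x)
    comul (S h1) *t comul h2 *t R y).
  rewrite -[LHS](comul_counitrE (G := fun h => comul (S h))); last by lin.
  apply: eq_tsum => h1 x.
  transitivity (comul (S h1) *t \sw_(a \ox y <- comul x) comul a *t R y).
    by rewrite ER (linear_funZ _ (bm.2 _)) tensor_hopf1r.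
  rewrite (bilinear_tsumr _ _ _ bm).
  by apply: eq_tsum => a y; rewrite tensor_hopfA.
rewrite -(@comul_coassoc _ (fun h1 h2 y => comul (S h1) *t comul h2 *t R y));
  last by lin.
rewrite -[RHS](comul_counitlE _ lR); apply: eq_tsum => q y.
under eq_tsum => h1 h2 do rewrite -comulM.
rewrite (@tsum_antipodel _ (fun z => comul z *t R y)); last by lin.
by rewrite comul1 tensor_hopf1l.
Qed.

Lemma tsum_comul_antipode U (F : H -> H -> U) h : bilinear_for *:%R *:%R F ->
  tsum (comul (S h)) F = \sw_(h1 \ox h2 <- comul h) F (S h2) (S h1).
Proof.
move=> bF; rewrite comul_antipode tsum_tsum //.
by apply: eq_tsum => h1 h2; rewrite tsum_pure.
Qed.

(** * Dual bases from integrals, and bijectivity of the antipode *)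

Section Integral.
Variables (Lambda : H) (lambda : {scalar H}).
Hypothesis Lambda_integral : left_integral Lambda.
Hypothesis lambda_integral : right_dual_integral lambda.
Hypothesis lambda_Lambda : lambda Lambda = 1.

(** Evaluate [S(h_1) h_2 Lambda_1 \ox h_3 Lambda_2] in two ways: by the antipode on the first two
    legs of [h], or by [comul (p * Lambda) = counit p *: comul Lambda] on the last two. *)
Lemma integral_shift U (F : H -> H -> U) h : bilinear_for *:%R *:%R F ->
  \sw_(x \ox y <- comul Lambda) F (S h * x) y =
  \sw_(x \ox y <- comul Lambda) F x (h * y).
Proof.
move=> bF; pose G g y := \sw_(u \ox v <- comul Lambda) F (g * u) (y * v).
transitivity (\sw_(h1 \ox p <- comul h) \sw_(h2 \ox h3 <- comul p)
    G (S h1 * h2) h3).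
  rewrite -[LHS](comul_counitrE (G := fun h => \sw_(x \ox y <- comul Lambda)
    F (S h * x) y)); last by lin.
  apply: eq_tsum => h1 p.
  transitivity (tsum (comul (p * Lambda)) (fun x y => F (S h1 * x) y)).
    by rewrite Lambda_integral linearZ /= (linear_funZ _ (tsum_linear _)) //; lin.
  rewrite tsum_comulM; last by lin.
  by do 2 (apply: eq_tsum => ? ?); rewrite mulrA.
rewrite -(@comul_coassoc _ (fun h1 h2 h3 => G (S h1 * h2) h3)); last first.
  by rewrite /G; lin.
transitivity (G 1 h); last by apply: eq_tsum => x y; rewrite mul1r.
rewrite -[RHS](comul_counitlE (G := G 1)); last by rewrite /G; lin.
apply: eq_tsum => x h3.
by rewrite (@tsum_antipodel _ (fun z => G z h3)) // /G; lin.
Qed.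

(** After the shift [h] stands outside, and [lambda(Lambda_1) Lambda_2 = lambda(Lambda) 1]. *)
Lemma antipode_dual_basis h :
  \sw_(x \ox y <- comul Lambda) lambda (S h * x) *: y = h.
Proof.
rewrite (@integral_shift _ (fun x y => lambda x *: y)); last by lin.
transitivity (h * \sw_(x \ox y <- comul Lambda) lambda x *: y).
  rewrite (bilinear_tsumr _ _ _ (alg_mul_bilinear H)).
  by apply: eq_tsum => x y; rewrite scalerAr.
by rewrite lambda_integral lambda_Lambda scale1r mulr1.
Qed.

Local Notation Sinv := (@antipode_inv k H).

Lemma antipode_lker0 : (lker (linfun S) == 0)%VS.
Proof.
apply/lker0P => g h; rewrite !lfunE /= => e.
by rewrite -[g]antipode_dual_basis e antipode_dual_basis.
Qed.

Lemma antipodeK : cancel S Sinv.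
Proof.
by move=> h; have := lker0_lfunK antipode_lker0 h; rewrite lfunE.
Qed.

(** An injective endomorphism of a finite-dimensional space is onto. *)
Lemma antipode_invK : cancel Sinv S.
Proof.
by move=> h; have := lker0_lfunVK antipode_lker0 h; rewrite lfunE.
Qed.

Lemma antipode_integral_left h : S Lambda * S h = counit h *: S Lambda.
Proof. by rewrite -antipodeM Lambda_integral linearZ. Qed.

Lemma antipode_integral h : S Lambda * h = counit h *: S Lambda.
Proof.
rewrite -[h in LHS]antipode_invK antipode_integral_left.
by rewrite -[h in RHS]antipode_invK counit_antipode.
Qed.

(** Apply [lambda] to the dual basis formula at [Lambda]. Since [S Lambda] is a right integral,
    [lambda(S(Lambda) Lambda_1) lambda(Lambda_2)] is [lambda(S Lambda) lambda(Lambda)]. *)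
Lemma lambda_antipode_Lambda : lambda (S Lambda) = 1.
Proof.
have := congr1 lambda (antipode_dual_basis Lambda).
rewrite lambda_Lambda => <-.
rewrite (linear_tsum _ _ (linear_scalar lambda)).
transitivity (\sw_(x \ox y <- comul Lambda)
   counit x *: (lambda (S Lambda) * lambda y : k^o)).
  rewrite (comul_counitlE (G := fun y => (lambda (S Lambda) * lambda y : k^o))).
    by rewrite lambda_Lambda mulr1.
  by move=> c x y; rewrite linearD linearZ /= mulrDr mulrCA.
apply: eq_tsum => x y; rewrite linearZ antipode_integral linearZ /=.
have -> : lambda (counit x *: S Lambda) = counit x * lambda (S Lambda).
  by rewrite linearZ.
by rewrite -mulrA; exact: mulrCA.
Qed.

(** Replace [lambda(x) 1] by [lambda(x_1) x_2] at [x = S(g_2) h]; the factor [S(g_2)] so released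
    cancels [g_1]. This gives the second dual basis formula, and it is also the colinearity of the
    reference Casimir morphism. *)
Lemma lambda_antipode_swap U (G : H -> U) g h : linear G ->
  \sw_(g1 \ox g2 <- comul g) lambda (S g2 * h) *: G g1 =
  \sw_(h1 \ox h2 <- comul h) lambda (S g * h1) *: G h2.
Proof.
move=> lG.
have E x : \sw_(x1 \ox x2 <- comul x) lambda x1 *: x2 = lambda x *: 1.
  exact: lambda_integral.
transitivity (\sw_(g1 \ox p <- comul g) \sw_(p1 \ox p2 <- comul p)
    \sw_(h1 \ox h2 <- comul h) lambda (S p2 * h1) *: G (g1 * S p1 * h2)).
  apply: eq_tsum => g1 p.
  transitivity (G (g1 * (lambda (S p * h) *: 1))).
    by rewrite -scalerAr mulr1 (linear_funZ _ lG).
  rewrite -E tsum_comulM; last by lin.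
  rewrite tsum_comul_antipode; last by lin.
  rewrite (bilinear_tsumr _ _ _ (alg_mul_bilinear H)) (linear_tsum _ _ lG).
  apply: eq_tsum => p1 p2.
  rewrite (bilinear_tsumr _ _ _ (alg_mul_bilinear H)) (linear_tsum _ _ lG).
  by apply: eq_tsum => h1 h2; rewrite -scalerAr (linear_funZ _ lG) mulrA.
rewrite -(@comul_coassoc _ (fun g1 p1 p2 => \sw_(h1 \ox h2 <- comul h)
  lambda (S p2 * h1) *: G (g1 * S p1 * h2))); last by lin.
rewrite -[RHS](comul_counitlE (G := fun g => \sw_(h1 \ox h2 <- comul h)
  lambda (S g * h1) *: G h2)); last by lin.
apply: eq_tsum => q p2.
rewrite (@tsum_antipoder _ (fun z => \sw_(h1 \ox h2 <- comul h)
  lambda (S p2 * h1) *: G (z * h2))); last by lin.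
by under eq_tsum => h1 h2 do rewrite mul1r.
Qed.

(** The swap moves the coproduct from [Lambda] to [h], and [S Lambda] then absorbs [h_1] as a right
    integral. *)
Lemma antipode_dual_basisr h :
  \sw_(x \ox y <- comul Lambda) lambda (S y * h) *: x = h.
Proof.
rewrite (@lambda_antipode_swap _ (fun x => x)) //.
rewrite -[RHS](comul_counitlE (G := fun x => x)) //.
apply: eq_tsum => h1 h2; rewrite antipode_integral linearZ /=.
by rewrite lambda_antipode_Lambda mulr1.
Qed.

(** * The distinguished grouplike element and the Nakayama automorphism *)

Variable mu : {scalar H}.
Hypothesis mu_grouplike : distinguished_grouplike mu.

(** [distinguished_grouplike] speaks of some nonzero integral [L]. The second dual basis formula
    gives [L = lambda(L) Lambda], so [lambda(L)] is nonzero and the relation passes to [Lambda]. *)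
Lemma integral_mulr h : Lambda * h = mu h *: Lambda.
Proof.
case: mu_grouplike => _ [L [L0 Lint Lmu]].
have EL : L = lambda L *: Lambda.
  rewrite -[LHS]antipode_dual_basisr.
  rewrite -[in RHS](comul_counitr Lambda) /tsum scaler_sumr.
  apply: eq_bigr => p _; rewrite Lint linearZ /= counit_antipode.
  by rewrite scalerA mulrC.
have l0 : lambda L != 0.
  by apply/negP => /eqP l0; case/negP: L0; rewrite EL l0 scale0r.
apply: (scalerI l0); rewrite scalerAl -EL Lmu {1}EL.
by rewrite !scalerA mulrC.
Qed.

(** The mirror image of [integral_shift], from [Lambda_1 a_1 \ox Lambda_2 a_2 S(a_3)]; the counit is
    replaced by [mu] because [Lambda] is multiplied on the right. *)
Lemma integral_shiftr U (F : H -> H -> U) a : bilinear_for *:%R *:%R F ->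
  \sw_(x \ox y <- comul Lambda) F (x * a) y =
  \sw_(a1 \ox a2 <- comul a) mu a1 *:
    \sw_(x \ox y <- comul Lambda) F x (y * S a2).
Proof.
move=> bF.
transitivity (\sw_(a1 \ox p <- comul a) \sw_(a2 \ox a3 <- comul p)
    \sw_(x \ox y <- comul Lambda) F (x * a1) (y * (a2 * S a3))).
  rewrite -[LHS](comul_counitrE (G := fun a => \sw_(x \ox y <- comul Lambda)
    F (x * a) y)); last by lin.
  apply: eq_tsum => a1 p.
  rewrite (@tsum_antipoder _ (fun z => \sw_(x \ox y <- comul Lambda)
    F (x * a1) (y * z))); last by lin.
  by under [in RHS]eq_tsum => x y do rewrite mulr1.
rewrite -(@comul_coassoc _ (fun a1 a2 a3 => \sw_(x \ox y <- comul Lambda)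
   F (x * a1) (y * (a2 * S a3)))); last by lin.
apply: eq_tsum => q a3.
transitivity (tsum (comul (Lambda * q)) (fun x y => F x (y * S a3))).
  rewrite tsum_comulM; last by lin.
  rewrite exchange_tsum; do 2 (apply: eq_tsum => ? ?).
  by rewrite mulrA.
rewrite integral_mulr linearZ /= (linear_funZ _ (tsum_linear _)) //; lin.
Qed.

(* [a |-> mu(a_1) S^2(a_2)] is the Nakayama automorphism of [lambda]. *)
Lemma lambda_mulC U (v : U) x a :
  lambda (x * a) *: v =
  \sw_(a1 \ox a2 <- comul a) mu a1 *: (lambda (S (S a2) * x) *: v).
Proof.
(* Expanding [x] leaves [lambda(Lambda_1 a)]; the shift moves [a] to the second leg, where it comes
   out as [S(S(a_2))], and [lambda(Lambda_1) Lambda_2 = 1] removes the basis again. *)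
rewrite -[x in LHS]antipode_dual_basisr.
rewrite (bilinear_tsuml _ _ _ (alg_mul_bilinear H)).
transitivity (\sw_(y \ox z <- comul Lambda)
  lambda (y * a) *: (lambda (S z * x) *: v)).
  rewrite (linear_tsum _ _ (linear_scalar lambda)) /tsum scaler_suml.
  apply: eq_bigr => p _.
  by rewrite -scalerAl linearZ /= scalerA mulrC.
rewrite (@integral_shiftr _ (fun y z => lambda y *: (lambda (S z * x) *: v)));
  last by lin.
apply: eq_tsum => a1 a2; congr (_ *: _).
transitivity (\sw_(y \ox z <- comul Lambda)
   lambda y *: (lambda (S (S a2) * (S z * x)) *: v)).
  by apply: eq_tsum => y z; rewrite antipodeM mulrA.
have lG : linear (fun z => lambda (S (S a2) * (S z * x)) *: v) by lin.
transitivity (lambda (S (S a2) *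
   (S (\sw_(y \ox z <- comul Lambda) lambda y *: z) * x)) *: v).
  rewrite (linear_tsum _ _ lG).
  by apply: eq_tsum => y z; rewrite (linear_funZ _ lG).
by rewrite lambda_integral lambda_Lambda scale1r antipode1 mul1r.
Qed.

Lemma antipode_inv_linear : linear Sinv.
Proof. exact: linearP. Qed.

Lemma antipode_invM g h : Sinv (g * h) = Sinv h * Sinv g.
Proof.
by apply: (can_inj antipodeK); rewrite antipodeM !antipode_invK.
Qed.

Lemma antipode_inv1 : Sinv 1 = 1.
Proof. by apply: (can_inj antipodeK); rewrite antipode1 antipode_invK. Qed.

Lemma tsum_comul_antipode_inv U (F : H -> H -> U) h :
  bilinear_for *:%R *:%R F ->
  tsum (comul (Sinv h)) F = \sw_(h1 \ox h2 <- comul h) F (Sinv h2) (Sinv h1).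
Proof.
move=> bF; have lS := antipode_inv_linear.
rewrite -[h in RHS]antipode_invK tsum_comul_antipode; last by lin.
by apply: eq_tsum => h1 h2; rewrite !antipodeK.
Qed.

(** [Sinv] is the antipode for the opposite multiplication, whence the reversed order of the
    legs. *)
Lemma tsum_antipode_invl U (G : H -> U) h : linear G ->
  \sw_(h1 \ox h2 <- comul h) G (Sinv h2 * h1) = counit h *: G 1.
Proof.
move=> lG; have lS := antipode_inv_linear.
rewrite -[in RHS]antipode_inv1 -(@tsum_antipodel _ (fun x => G (Sinv x)));
  last by lin.
by apply: eq_tsum => h1 h2; rewrite antipode_invM antipodeK.
Qed.

Lemma tsum_antipode_invr U (G : H -> U) h : linear G ->
  \sw_(h1 \ox h2 <- comul h) G (h2 * Sinv h1) = counit h *: G 1.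
Proof.
move=> lG; have lS := antipode_inv_linear.
rewrite -[in RHS]antipode_inv1 -(@tsum_antipoder _ (fun x => G (Sinv x)));
  last by lin.
by apply: eq_tsum => h1 h2; rewrite antipode_invM antipodeK.
Qed.

End Integral.

End Hopf.

(** * The cowreath as an entwining structure *)

Section Comodule.
Variables (k : fieldType) (H : finHopfAlgType k) (A : comodAlgType H).
Implicit Types (U : lmodType k).

Lemma coact_coassoc U (F : A -> H -> H -> U) a : trilinear F ->
  \sw_(x \ox a2 <- coact a) \sw_(a0 \ox a1 <- coact x) F a0 a1 a2 =
  \sw_(a0 \ox x <- coact a) \sw_(a1 \ox a2 <- comul x) F a0 a1 a2.
Proof.
move=> tF; have lF := tsum3_linear tF.
have := congr1 (fun t => \sw_(x \ox y \ox z <- t) F x y z) (coactA a).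
rewrite /= !(linear_tsum _ _ lF) => e.
transitivity (\sw_(x \ox a2 <- coact a) \sw_(y \ox z \ox w <-
    \sw_(a0 \ox a1 <- coact x) a0 \ox a1 \ox a2) F y z w).
  apply: eq_tsum => x a2; rewrite (linear_tsum _ _ lF).
  by apply: eq_tsum => a0 a1; rewrite tsum3_pure.
rewrite e; apply: eq_tsum => a0 x; rewrite (linear_tsum _ _ lF).
by apply: eq_tsum => a1 a2; rewrite tsum3_pure.
Qed.

Lemma coact_counitE U (G : A -> U) a : linear G ->
  \sw_(a0 \ox a1 <- coact a) counit a1 *: G a0 = G a.
Proof.
move=> lG; rewrite -[in RHS](coact_counit a) (linear_tsum _ _ lG).
by apply: eq_tsum => x y; rewrite (linear_funZ _ lG).
Qed.

Lemma tsum_coactM U (F : A -> H -> U) a b : bilinear_for *:%R *:%R F ->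
  tsum (coact (a * b)) F =
  \sw_(a0 \ox a1 <- coact a) \sw_(b0 \ox b1 <- coact b) F (a0 * b0) (a1 * b1).
Proof.
move=> bF; rewrite coactM /tensor_mul tsum_tsum //; apply: eq_tsum => a0 a1.
by rewrite tsum_tsum //; apply: eq_tsum => b0 b1; rewrite tsum_pure.
Qed.

Lemma tsum_coact1 U (F : A -> H -> U) : bilinear_for *:%R *:%R F ->
  tsum (coact (1 : A)) F = F 1 1.
Proof. by move=> bF; rewrite coact1 tsum_pure. Qed.

Lemma tsum_coact2 U (F : A -> H -> H -> U) a : trilinear F ->
  \sw_(a0 \ox a1 \ox a2 <- coact2 a) F a0 a1 a2 =
  \sw_(a0 \ox x <- coact a) \sw_(a1 \ox a2 <- comul x) F a0 a1 a2.
Proof.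
move=> tF; have lF := tsum3_linear tF; case: tF => F1 F2 F3.
have bF x : bilinear_for *:%R *:%R (F x) by split.
rewrite /coact2 (linear_tsum _ _ lF); apply: eq_tsum => a0 x.
rewrite tsum_pure //; split=> [w|v]; last exact: tsum_linear.
by move=> c y z; apply: tsum_linear_body => *; exact: F1.
Qed.

Lemma tsum_comul2 U (F : H -> H -> H -> U) h : trilinear F ->
  \sw_(h1 \ox h2 \ox h3 <- comul2 h) F h1 h2 h3 =
  \sw_(h1 \ox x <- comul h) \sw_(h2 \ox h3 <- comul x) F h1 h2 h3.
Proof.
move=> tF; have lF := tsum3_linear tF; case: tF => F1 F2 F3.
have bF x : bilinear_for *:%R *:%R (F x) by split.
rewrite /comul2 (linear_tsum _ _ lF); apply: eq_tsum => h1 x.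
rewrite tsum_pure //; split=> [w|v]; last exact: tsum_linear.
by move=> c y z; apply: tsum_linear_body => *; exact: F1.
Qed.

Local Notation E := (A \ox H)%type.
Local Notation oneE := ((1 : A) \ox (1 : H)).

Definition opmul (x y : E) : E := x *o y.

Lemma op_mul_bilinear :
  bilinear_for *:%R *:%R (fun u v : H => v * u).
Proof. by lin. Qed.

Lemma opmul_bilinear : bilinear_for *:%R *:%R opmul.
Proof.
exact: tensor_mul_bilinear (@unital_mul_bilinear k A) op_mul_bilinear.
Qed.

Lemma opmul_pure a l b r : opmul (a \ox l) (b \ox r) = (a * b) \ox (r * l).
Proof.
exact: tensor_mul_pure (@unital_mul_bilinear k A) op_mul_bilinear _ _ _ _.
Qed.

Lemma opmulA : associative opmul.
Proof.
apply: tensor_mulA; [exact: unital_mul_bilinear | exact: op_mul_bilinear | |].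
  exact: mulrA.
by move=> x y z; rewrite mulrA.
Qed.

Lemma opmul1l : left_id oneE opmul.
Proof.
apply: tensor_mul1; [exact: unital_mul_bilinear | exact: op_mul_bilinear | |].
  exact: mul1r.
exact: mulr1.
Qed.

Lemma opmul1r : right_id oneE opmul.
Proof.
apply: tensor_mulr1; [exact: unital_mul_bilinear | exact: op_mul_bilinear | |].
  exact: mulr1.
exact: mul1r.
Qed.

(* [cowreath_psi] has values in [A \ox (H \ox H)], an entwining map in
   [(A \ox H) \ox H]. *)
Definition tassoc (t : (A \ox (H \ox H))%type) : (E \ox H)%type :=
  \sw_(a \ox x \ox y <- t) (a \ox x) \ox y.

Definition tassoc_inv (t : (E \ox H)%type) : (A \ox (H \ox H))%type :=
  \sw_(e \ox y <- t) \sw_(a \ox x <- e) a \ox x \ox y.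

Lemma tassoc_linear : linear tassoc.
Proof. by rewrite /tassoc; lin. Qed.

Lemma tassoc_inv_linear : linear tassoc_inv.
Proof. by rewrite /tassoc_inv; lin. Qed.

Lemma tassocK : cancel tassoc tassoc_inv.
Proof.
move=> t; rewrite /tassoc (linear_tsum _ _ tassoc_inv_linear) -[RHS]tsum_id.
apply: eq_tsum => a p; rewrite (linear_tsum _ _ tassoc_inv_linear).
rewrite -[p in RHS]tsum_id (bilinear_tsumr _ _ _ (pure_tensor_bilinear _ _)).
apply: eq_tsum => x y; rewrite /tassoc_inv tsum_pure; last by lin.
by rewrite tsum_pure //; lin.
Qed.

Lemma tassoc_pure a x y : tassoc (a \ox x \ox y) = (a \ox x) \ox y.
Proof. by rewrite /tassoc tsum3_pure //; lin. Qed.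

Lemma tsum_tassoc U (F : E -> H -> U) t : bilinear_for *:%R *:%R F ->
  tsum (tassoc t) F = \sw_(a \ox x \ox y <- t) F (a \ox x) y.
Proof.
move=> bF; rewrite /tassoc tsum_tsum //; apply: eq_tsum => a p.
by rewrite tsum_tsum //; apply: eq_tsum => x y; rewrite tsum_pure.
Qed.

Definition psi (h : H) (x : E) : (E \ox H)%type := tassoc (cowreath_psi h x).

Lemma psi_bilinear : bilinear_for *:%R *:%R psi.
Proof.
have l := tassoc_linear; have b : bilinear_for *:%R *:%R (@cowreath_psi k H A).
  by rewrite /cowreath_psi; lin.
by rewrite /psi; lin.
Qed.

Lemma tsum_psi U (F : E -> H -> U) h a l : bilinear_for *:%R *:%R F ->
  tsum (psi h (a \ox l)) F = \sw_(a0 \ox a1 <- coact a)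
    \sw_(l1 \ox l2 <- comul l) F (a0 \ox l1) (l2 * h * a1).
Proof.
move=> bF; rewrite /psi /cowreath_psi tsum_pure; last by lin.
rewrite (linear_tsum _ _ tassoc_linear) tsum_tsum //; apply: eq_tsum => a0 a1.
rewrite (linear_tsum _ _ tassoc_linear) tsum_tsum //; apply: eq_tsum => l1 l2.
by rewrite tassoc_pure tsum_pure.
Qed.

(** The twist by [H^op] makes [h |-> l h a] a right action of the pair: [(r_2 l_2) h (a_1 b_1) = r_2
    (l_2 h a_1) b_1]. *)
Lemma psi_mul U (F : E -> H -> U) h x y : bilinear_for *:%R *:%R F ->
  tsum (psi h (opmul x y)) F =
  \sw_(x' \ox g <- psi h x) \sw_(y' \ox g' <- psi g y) F (opmul x' y') g'.
Proof.
move=> bF; have bm := opmul_bilinear; have bp := psi_bilinear.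
apply: (tensor_linear_ext (f := fun x => tsum (psi h (opmul x y)) F)
  (g := fun x => \sw_(x' \ox g <- psi h x) \sw_(y' \ox g' <- psi g y)
      F (opmul x' y') g')); [by lin..|].
move=> {x} a l; set x := _ \ox _.
apply: (tensor_linear_ext (f := fun y => tsum (psi h (opmul x y)) F)
  (g := fun y => \sw_(x' \ox g <- psi h x) \sw_(y' \ox g' <- psi g y)
      F (opmul x' y') g')); [by lin..|].
move=> {y} b r; rewrite /x opmul_pure !tsum_psi //; last by lin.
rewrite tsum_coactM; last by lin.
apply: eq_tsum => a0 a1.
transitivity (\sw_(l1 \ox l2 <- comul l) \sw_(b0 \ox b1 <- coact b)
    \sw_(r1 \ox r2 <- comul r)
      F ((a0 * b0) \ox (r1 * l1)) (r2 * l2 * h * (a1 * b1))).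
  rewrite [RHS]exchange_tsum; apply: eq_tsum => b0 b1.
  by rewrite tsum_comulM; [rewrite exchange_tsum | lin].
apply: eq_tsum => l1 l2; rewrite tsum_psi; last by lin.
apply: eq_tsum => b0 b1; apply: eq_tsum => r1 r2.
by rewrite opmul_pure !mulrA.
Qed.

Lemma psi_one h : psi h oneE = oneE \ox h.
Proof.
rewrite -[LHS]tsum_id tsum_psi; last by lin.
rewrite tsum_coact1; last by lin.
by rewrite tsum_comul1 ?mul1r ?mulr1 //; lin.
Qed.

Lemma psi_comul U (F : E -> H -> H -> U) h e : trilinear F ->
  \sw_(x \ox g <- psi h e) \sw_(g1 \ox g2 <- comul g) F x g1 g2 =
  \sw_(h1 \ox h2 <- comul h) \sw_(x \ox g2 <- psi h2 e)
    \sw_(y \ox g1 <- psi h1 x) F y g1 g2.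
Proof.
move=> tF; have bp := psi_bilinear.
apply: (tensor_linear_ext
  (f := fun e => \sw_(x \ox g <- psi h e) \sw_(g1 \ox g2 <- comul g) F x g1 g2)
  (g := fun e => \sw_(h1 \ox h2 <- comul h) \sw_(x \ox g2 <- psi h2 e)
    \sw_(y \ox g1 <- psi h1 x) F y g1 g2)); [by lin..|].
move=> {e} a l; rewrite tsum_psi; last by lin.
transitivity (\sw_(h1 \ox h2 <- comul h) \sw_(a0 \ox x <- coact a)
    \sw_(a1 \ox a2 <- comul x) \sw_(l1 \ox y <- comul l)
    \sw_(l2 \ox l3 <- comul y)
      F (a0 \ox l1) (l2 * h1 * a1) (l3 * h2 * a2)).
  rewrite [RHS]exchange_tsum; apply: eq_tsum => a0 x.
  under [RHS]eq_tsum => h1 h2 do rewrite exchange_tsum.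
  rewrite [RHS]exchange_tsum; apply: eq_tsum => l1 y.
  rewrite tsum_comulM; last by lin.
  rewrite tsum_comulM; last by lin.
  rewrite exchange_tsum; apply: eq_tsum => h1 h2.
  by rewrite exchange_tsum.
apply: eq_tsum => h1 h2; rewrite tsum_psi; last by lin.
transitivity (\sw_(x \ox a2 <- coact a) \sw_(a0 \ox a1 <- coact x)
    \sw_(z \ox l3 <- comul l) \sw_(l1 \ox l2 <- comul z)
      F (a0 \ox l1) (l2 * h1 * a1) (l3 * h2 * a2)).
  rewrite (@coact_coassoc _ (fun a0 a1 a2 => \sw_(z \ox l3 <- comul l)
    \sw_(l1 \ox l2 <- comul z) F (a0 \ox l1) (l2 * h1 * a1) (l3 * h2 * a2)));
    last by lin.
  apply: eq_tsum => a0 x; apply: eq_tsum => a1 a2.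
  by rewrite (@comul_coassoc _ _ _ (fun l1 l2 l3 => F (a0 \ox l1) (l2 * h1 * a1)
    (l3 * h2 * a2))) //; lin.
apply: eq_tsum => x a2; rewrite exchange_tsum; apply: eq_tsum => z l3.
by rewrite tsum_psi //; lin.
Qed.

End Comodule.

(** * Frobenius pairs of the cowreath as Frobenius pairs of the entwining *)

Section FrobeniusPair.
Variables (k : fieldType) (H : finHopfAlgType k) (A : comodAlgType H).
Local Notation E := (A \ox H)%type.
Local Notation oneE := ((1 : A) \ox (1 : H)).
Local Notation psi := (@psi k H A).
Local Notation opmul := (@opmul k H A).

(** This and its mirror image explain the ordinary products in [frobenius_pair]: a product with [a]
    and [g] on opposite sides is a one-sided product with [a \ox g] in [A \ox H^op]. *)
Lemma opmul_sandwichl (a : A) (g : H) (x : E) :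
  (a \ox 1) *t x *t ((1 : A) \ox g) = opmul (a \ox g) x.
Proof.
have bm := @opmul_bilinear k H A.
have bA := @unital_mul_bilinear k A; have bH := alg_mul_bilinear H.
apply: (tensor_linear_ext (f := fun x => (a \ox 1) *t x *t ((1 : A) \ox g))
  (g := fun x => opmul (a \ox g) x)); [by lin..|].
move=> b u; rewrite !tensor_mul_pure //.
by rewrite opmul_pure mulr1 mul1r.
Qed.

Lemma opmul_sandwichr (a : A) (g : H) (x : E) :
  ((1 : A) \ox g) *t x *t (a \ox 1) = opmul x (a \ox g).
Proof.
have bm := @opmul_bilinear k H A.
have bA := @unital_mul_bilinear k A; have bH := alg_mul_bilinear H.
apply: (tensor_linear_ext (f := fun x => ((1 : A) \ox g) *t x *t (a \ox 1))
  (g := fun x => opmul x (a \ox g))); [by lin..|].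
move=> b u; rewrite !tensor_mul_pure //.
by rewrite opmul_pure mulr1 mul1r.
Qed.

Section Curry.
Variable B : {linear (H \ox H)%type -> E}.

Definition curry_tensor (h h' : H) : E := B (h \ox h').

Lemma curry_tensor_bilinear : bilinear_for *:%R *:%R curry_tensor.
Proof. by rewrite /curry_tensor; lin. Qed.

Let bc := curry_tensor_bilinear.
Let bm := @opmul_bilinear k H A.
Let bp := @psi_bilinear k H A.

(** Applying [psi] at [h'] and then at [h] consumes the legs of [a] and [g] from the last inwards,
    so the iterated coproducts must be bracketed to the left before they match. *)
Lemma casimirP : casimir B <-> entw_casimir (@comul k H) opmul psi curry_tensor.
Proof.
have ER h h' (a : A) (g : H) :
    \sw_(a0 \ox a1 \ox a2 <- coact2 a) \sw_(g1 \ox g2 \ox g3 <- comul2 g)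
       (a0 \ox 1) *t B ((g2 * h * a1) \ox (g3 * h' * a2)) *t ((1 : A) \ox g1) =
    \sw_(x \ox g' <- psi h' (a \ox g)) \sw_(y \ox g'' <- psi h x)
      opmul y (curry_tensor g'' g').
  transitivity (\sw_(a0 \ox a1 \ox a2 <- coact2 a)
     \sw_(g1 \ox g2 \ox g3 <- comul2 g)
       opmul (a0 \ox g1) (curry_tensor (g2 * h * a1) (g3 * h' * a2))).
    by do 4 (apply: eq_tsum => ? ?); rewrite opmul_sandwichl.
  rewrite (@tsum_coact2 _ _ _ _ (fun a0 a1 a2 =>
     \sw_(g1 \ox g2 \ox g3 <- comul2 g)
       opmul (a0 \ox g1) (curry_tensor (g2 * h * a1) (g3 * h' * a2)))); last by lin.
  rewrite -coact_coassoc; last by lin.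
  rewrite tsum_psi; last by lin.
  apply: eq_tsum => a0' a2.
  transitivity (\sw_(a0 \ox a1 <- coact a0') \sw_(x \ox g3 <- comul g)
    \sw_(g1 \ox g2 <- comul x)
      opmul (a0 \ox g1) (curry_tensor (g2 * h * a1) (g3 * h' * a2))).
    apply: eq_tsum => a0 a1; rewrite tsum_comul2; last by lin.
    by rewrite -comul_coassoc //; lin.
  rewrite exchange_tsum; apply: eq_tsum => x g3.
  by rewrite tsum_psi //; lin.
have EL h h' : \sw_(h1 \ox h2 <- comul h) psi h1 (curry_tensor h2 h') =
    tassoc (\sw_(h1 \ox h2 <- comul h) cowreath_psi h1 (B (h2 \ox h'))).
  by rewrite (linear_tsum _ _ (@tassoc_linear k H A)).
have EM h h' :
    \sw_(h'1 \ox h'2 <- comul h') curry_tensor h h'1 \ox h'2 =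
    tassoc (\sw_(h'1 \ox h'2 <- comul h')
       \sw_(b \ox u <- B (h \ox h'1)) b \ox u \ox h'2).
  rewrite (linear_tsum _ _ (@tassoc_linear k H A)); apply: eq_tsum => h1 h2.
  rewrite (linear_tsum _ _ (@tassoc_linear k H A)) /curry_tensor.
  rewrite -[B _ in LHS]tsum_id.
  rewrite (bilinear_tsuml _ _ _ (pure_tensor_bilinear _ _)).
  by apply: eq_tsum => b u; rewrite tassoc_pure.
split=> [] [C1 C2]; split.
- move=> h h'; apply: (tensor_linear_ext (f := fun e => opmul (curry_tensor h h') e)
    (g := fun e => \sw_(x \ox g' <- psi h' e) \sw_(y \ox g <- psi h x)
      opmul y (curry_tensor g g'))); [by lin..|].
  by move=> a g; rewrite -ER C1 opmul_sandwichr.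
- by move=> h h'; rewrite EL EM C2.
- by move=> a g h h'; rewrite ER opmul_sandwichr -C1.
- by move=> h h'; apply: (can_inj (@tassocK k H A)); rewrite -EL -EM C2.
Qed.

Lemma frobenius_pairP (t : (A \ox (H \ox H))%type) : frobenius_pair B t <->
  entw_frobenius (@comul k H) (@counit k H) oneE opmul psi curry_tensor (tassoc t).
Proof.
have ET (a : A) (h : H) :
    \sw_(t1 \ox t2 <- tassoc t) opmul (a \ox h) t1 \ox t2 =
    tassoc (\sw_(t1 \ox t2 \ox t3 <- t) (a * t1) \ox (t2 * h) \ox t3).
  rewrite tsum_tassoc; last by lin.
  rewrite (linear_tsum _ _ (@tassoc_linear k H A)); apply: eq_tsum => t1 p.
  rewrite (linear_tsum _ _ (@tassoc_linear k H A)); apply: eq_tsum => t2 t3.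
  by rewrite tassoc_pure opmul_pure.
have ET' (a : A) (h : H) :
    \sw_(t1 \ox t2 <- tassoc t) \sw_(x \ox g <- psi t2 (a \ox h)) opmul t1 x \ox g =
    tassoc (\sw_(t1 \ox t2 \ox t3 <- t) \sw_(a0 \ox a1 <- coact a)
          \sw_(h1 \ox h2 <- comul h)
            (t1 * a0) \ox (h1 * t2) \ox (h2 * t3 * a1)).
  rewrite tsum_tassoc; last by lin.
  rewrite (linear_tsum _ _ (@tassoc_linear k H A)); apply: eq_tsum => t1 p.
  rewrite (linear_tsum _ _ (@tassoc_linear k H A)); apply: eq_tsum => t2 t3.
  rewrite tsum_psi; last by lin.
  rewrite (linear_tsum _ _ (@tassoc_linear k H A)); apply: eq_tsum => a0 a1.
  rewrite (linear_tsum _ _ (@tassoc_linear k H A)); apply: eq_tsum => h1 h2.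
  by rewrite tassoc_pure opmul_pure.
have E2 (h : H) : \sw_(t1 \ox t2 <- tassoc t) opmul t1 (curry_tensor t2 h) =
    \sw_(t1 \ox t2 \ox t3 <- t) (t1 \ox 1) *t B (t3 \ox h) *t ((1 : A) \ox t2).
  rewrite tsum_tassoc; last by lin.
  by do 2 (apply: eq_tsum => ? ?); rewrite opmul_sandwichl.
have E3 (h : H) : \sw_(t1 \ox t2 <- tassoc t) \sw_(x \ox g <- psi h t1)
      opmul x (curry_tensor g t2) =
    \sw_(t1 \ox t2 \ox t3 <- t) \sw_(t10 \ox t11 <- coact t1)
          \sw_(t21 \ox t22 <- comul t2)
            (t10 \ox 1) *t B ((t22 * h * t11) \ox t3) *t ((1 : A) \ox t21).
  rewrite tsum_tassoc; last by lin.
  do 2 (apply: eq_tsum => ? ?); rewrite tsum_psi; last by lin.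
  by do 2 (apply: eq_tsum => ? ?); rewrite opmul_sandwichl.
split=> [[/casimirP C T1 T2 T3]|[C T1 T2 T3]]; split=> //.
- move=> e; apply: (tensor_linear_ext
    (f := fun e => \sw_(t1 \ox t2 <- tassoc t) opmul e t1 \ox t2)
    (g := fun e => \sw_(t1 \ox t2 <- tassoc t) \sw_(x \ox g <- psi t2 e)
      opmul t1 x \ox g)); [by lin..|].
  by move=> a h; rewrite ET ET' T1.
- by move=> h; rewrite E2 T2.
- by move=> h; rewrite E3 T3.
- exact/casimirP.
- by move=> a h; apply: (can_inj (@tassocK k H A)); rewrite -ET -ET' T1.
- by move=> h; rewrite -E2 T2.
- by move=> h; rewrite -E3 T3.
Qed.

End Curry.
End FrobeniusPair.

(** * Bimodule maps and the centralizer of [coH] *)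

Section Centralizer.
Variables (k : fieldType) (H : finHopfAlgType k) (A : comodAlgType H).
Local Notation E := (A \ox H)%type.
Local Notation oneE := ((1 : A) \ox (1 : H)).
Local Notation psi := (@psi k H A).
Local Notation opmul := (@opmul k H A).
Local Notation Sinv := (@antipode_inv k H).
Local Notation opmulA := (@opmulA k H A).
Local Notation opmul1l := (@opmul1l k H A).
Local Notation opmul1r := (@opmul1r k H A).
Local Notation opmul_pure := (@opmul_pure k H A).
Let bm := @opmul_bilinear k H A.
Let bp := @psi_bilinear k H A.
Let lS := @antipode_inv_linear k H.

Variables (Lambda : H) (lambda : {scalar H}).
Hypothesis Lambda_integral : left_integral Lambda.
Hypothesis lambda_integral : right_dual_integral lambda.
Hypothesis lambda_Lambda : lambda Lambda = 1.

Local Notation SinvM :=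
  (antipode_invM Lambda_integral lambda_integral lambda_Lambda).
Local Notation comul_Sinv :=
  (tsum_comul_antipode_inv Lambda_integral lambda_integral lambda_Lambda).
Local Notation Sinvl :=
  (tsum_antipode_invl Lambda_integral lambda_integral lambda_Lambda).
Local Notation Sinvr :=
  (tsum_antipode_invr Lambda_integral lambda_integral lambda_Lambda).
Local Notation bimodule_map := (entw_bimodule_map opmul psi).

(** The map from [A] to [A \ox H^op] whose image is centralized by the elements satisfying
    [coH_centralizer]. *)
Definition coH_embed (a : A) : E := \sw_(a0 \ox a1 <- coact a) a0 \ox Sinv a1.

Lemma coH_centralizerP (x : E) : coH_centralizer x <->
  forall a, opmul x (coH_embed a) = opmul (coH_embed a) x.
Proof.
have EL a : opmul x (coH_embed a) = \sw_(b \ox u <- x)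
    \sw_(a0 \ox a1 <- coact a) (b * a0) \ox (Sinv a1 * u).
  rewrite -[x in LHS]tsum_id (bilinear_tsuml _ _ _ bm); apply: eq_tsum => b u.
  rewrite (bilinear_tsumr _ _ _ bm); apply: eq_tsum => a0 a1.
  by rewrite opmul_pure.
have ER a : opmul (coH_embed a) x = \sw_(b \ox u <- x)
    \sw_(a0 \ox a1 <- coact a) (a0 * b) \ox (u * Sinv a1).
  rewrite -[x in LHS]tsum_id (bilinear_tsumr _ _ _ bm); apply: eq_tsum => b u.
  rewrite (bilinear_tsuml _ _ _ bm); apply: eq_tsum => a0 a1.
  by rewrite opmul_pure.
by split=> Cx a; have := Cx a; rewrite EL ER.
Qed.

Lemma coH_centralizer_inverse (x y : E) :
  coH_centralizer x -> op_inverse x y -> coH_centralizer y.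
Proof.
move=> /coH_centralizerP Cx [xy yx]; apply/coH_centralizerP => a.
rewrite -[LHS](opmul1r (opmul y _)) -[oneE]xy.
rewrite -/(opmul x y) !opmulA -[opmul (opmul y _) x]opmulA -Cx opmulA.
by rewrite [opmul y x]yx opmul1l.
Qed.

(** With the product of [A \ox H^op] the map has the shape of a conjugation of [x], so that its
    convolution products telescope: [h_2] meets [Sinv h_3] in the middle. *)
Definition bimodule_of (x : E) (h : H) : E :=
  \sw_(h1 \ox h2 <- comul h) opmul (opmul ((1 : A) \ox Sinv h1) x) ((1 : A) \ox h2).

Lemma bimodule_of_bilinear : bilinear_for *:%R *:%R bimodule_of.
Proof. by rewrite /bimodule_of; lin. Qed.

Lemma bimodule_of_linear x : linear (bimodule_of x).
Proof. by case: bimodule_of_bilinear. Qed.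

Lemma bimodule_of_mul x y h :
  \sw_(h1 \ox h2 <- comul h) opmul (bimodule_of x h1) (bimodule_of y h2) =
  bimodule_of (opmul x y) h.
Proof.
transitivity (\sw_(h1 \ox p <- comul h) \sw_(h2 \ox q <- comul p)
   \sw_(h3 \ox h4 <- comul q)
     opmul (opmul (opmul ((1 : A) \ox Sinv h1) x) ((1 : A) \ox (Sinv h3 * h2)))
       (opmul y ((1 : A) \ox h4))).
  rewrite -(@comul_coassoc _ _ _ (fun h1 h2 q => \sw_(h3 \ox h4 <- comul q)
     opmul (opmul (opmul ((1 : A) \ox Sinv h1) x) ((1 : A) \ox (Sinv h3 * h2)))
       (opmul y ((1 : A) \ox h4)))); last by lin.
  apply: eq_tsum => p q; rewrite (bilinear_tsuml _ _ _ bm).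
  apply: eq_tsum => h1 h2; rewrite (bilinear_tsumr _ _ _ bm).
  apply: eq_tsum => h3 h4.
  by rewrite !opmulA -(opmulA _ ((1 : A) \ox h2)) opmul_pure mulr1.
rewrite /bimodule_of; apply: eq_tsum => h1 p.
rewrite -(@comul_coassoc _ _ _ (fun h2 h3 h4 =>
  opmul (opmul (opmul ((1 : A) \ox Sinv h1) x) ((1 : A) \ox (Sinv h3 * h2)))
       (opmul y ((1 : A) \ox h4)))); last by lin.
rewrite -[RHS](comul_counitlE (G := fun p =>
  opmul (opmul ((1 : A) \ox Sinv h1) (opmul x y)) ((1 : A) \ox p))); last by lin.
apply: eq_tsum => q h4.
rewrite (@Sinvl _ (fun z => opmul (opmul (opmul ((1 : A) \ox Sinv h1) x)
  ((1 : A) \ox z)) (opmul y ((1 : A) \ox h4)))); last by lin.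
by rewrite opmul1r !opmulA.
Qed.

Lemma bimodule_of_one h : bimodule_of oneE h = counit h *: oneE.
Proof.
rewrite -(@Sinvr _ (fun z => (1 : A) \ox z)); last by lin.
apply: eq_tsum => h1 h2.
by rewrite !opmul_pure !mulr1 mul1r.
Qed.

(** The last leg is [Sinv(a_2) a_1] and cancels. Hence right linearity of a bimodule map at [1] says
    that its value there commutes with the image of [coH_embed]. *)
Lemma psi_coH_embed (a : A) : psi 1 (coH_embed a) = coH_embed a \ox 1.
Proof.
rewrite /coH_embed (bilinear_tsumr _ _ _ bp).
rewrite (bilinear_tsuml _ _ _ (pure_tensor_bilinear _ _)).
transitivity (\sw_(a0 \ox z <- coact a) \sw_(a1 \ox a2 <- comul z)
    \sw_(l2 \ox l1 <- comul a2) (a0 \ox Sinv l1) \ox (Sinv l2 * a1)).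
  rewrite -(@coact_coassoc _ _ _ _ (fun a0 a1 a2 => \sw_(l2 \ox l1 <- comul a2)
    (a0 \ox Sinv l1) \ox (Sinv l2 * a1))); last by lin.
  apply: eq_tsum => a0 a2; rewrite -[LHS]tsum_id tsum_psi; last by lin.
  apply: eq_tsum => a0' a1; rewrite comul_Sinv; last by lin.
  by apply: eq_tsum => l2 l1; rewrite mulr1.
apply: eq_tsum => a0 z.
rewrite -(@comul_coassoc _ _ _ (fun a1 l2 l1 =>
  (a0 \ox Sinv l1) \ox (Sinv l2 * a1))); last by lin.
rewrite -[RHS](comul_counitlE (G := fun z => (a0 \ox Sinv z) \ox (1 : H)));
  last by lin.
apply: eq_tsum => y l1.
by rewrite (@Sinvl _ (fun z => (a0 \ox Sinv l1) \ox z)) //; lin.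
Qed.

Lemma bimodule_map_centralizer phi : linear phi -> bimodule_map phi ->
  coH_centralizer (phi 1).
Proof.
move=> lphi Zphi; apply/coH_centralizerP => a.
by rewrite Zphi psi_coH_embed tsum_pure //; lin.
Qed.

(** Right linearity in [1 \ox h] reads [phi(1) (1 \ox h) = (1 \ox h_1) phi(h_2)], and the inverse
    antipode solves this for [phi(h)]. *)
Lemma bimodule_mapE phi : linear phi -> bimodule_map phi ->
  forall h, phi h = bimodule_of (phi 1) h.
Proof.
move=> lphi Zphi h; rewrite /bimodule_of.
transitivity (\sw_(h1 \ox z <- comul h) \sw_(h2 \ox h3 <- comul z)
    opmul ((1 : A) \ox (h2 * Sinv h1)) (phi h3)).
  rewrite -(@comul_coassoc _ _ _ (fun h1 h2 h3 =>
    opmul ((1 : A) \ox (h2 * Sinv h1)) (phi h3))); last by lin.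
  rewrite -[LHS](comul_counitlE (G := phi)) //; apply: eq_tsum => p h3.
  rewrite (@Sinvr _ (fun z => opmul ((1 : A) \ox z) (phi h3))); last by lin.
  by rewrite opmul1l.
apply: eq_tsum => h1 z; rewrite -opmulA Zphi tsum_psi; last by lin.
rewrite tsum_coact1; last by lin.
rewrite (bilinear_tsumr _ _ _ bm); apply: eq_tsum => h2 h3.
by rewrite opmulA opmul_pure !mulr1.
Qed.

(** Since [a \ox l] is the product of [coH_embed a_0] and [1 \ox l a_1], the part in [A] can be
    moved across [x] by the centralizer condition. *)
Lemma bimodule_ofP x : coH_centralizer x -> bimodule_map (bimodule_of x).
Proof.
move=> /coH_centralizerP Cx h e; have lx := bimodule_of_linear x.
apply: (tensor_linear_ext (f := fun e => opmul (bimodule_of x h) e)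
  (g := fun e => \sw_(y \ox g <- psi h e) opmul y (bimodule_of x g)));
  [by lin..|].
move=> {e} a l; rewrite tsum_psi; last by lin.
pose P (u v : E) := opmul (opmul u x) v.
have bP : bilinear_for *:%R *:%R P by rewrite /P; lin.
transitivity (\sw_(h1 \ox h2 <- comul h) \sw_(a0 \ox z <- coact a)
    \sw_(a1 \ox a2 <- comul z)
      P (a0 \ox (Sinv a1 * Sinv h1)) ((1 : A) \ox (l * h2 * a2))).
  rewrite (bilinear_tsuml _ _ _ bm); apply: eq_tsum => h1 h2.
  transitivity (\sw_(y \ox a2 <- coact a) opmul ((1 : A) \ox Sinv h1)
      (P (coH_embed y) ((1 : A) \ox (l * h2 * a2)))).
    transitivity (\sw_(y \ox a2 <- coact a) \sw_(a0 \ox a1 <- coact y)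
       opmul (opmul ((1 : A) \ox Sinv h1) x) (a0 \ox (l * h2 * (a2 * Sinv a1)))).
      rewrite (@coact_coassoc _ _ _ _ (fun a0 a1 a2 =>
        opmul (opmul ((1 : A) \ox Sinv h1) x)
          (a0 \ox (l * h2 * (a2 * Sinv a1))))); last by lin.
      transitivity (opmul (opmul ((1 : A) \ox Sinv h1) x) (a \ox (l * h2))).
        by rewrite -opmulA opmul_pure mul1r.
      rewrite -[LHS](coact_counitE (G := fun a =>
        opmul (opmul ((1 : A) \ox Sinv h1) x) (a \ox (l * h2)))); last by lin.
      apply: eq_tsum => a0 z.
      rewrite (@Sinvr _ (fun z => opmul (opmul ((1 : A) \ox Sinv h1) x)
        (a0 \ox (l * h2 * z)))); last by lin.
      by rewrite mulr1.
    apply: eq_tsum => y a2; rewrite /P -Cx !opmulA.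
    rewrite -[opmul (opmul _ (coH_embed y)) _]opmulA.
    rewrite (bilinear_tsuml _ (fun u v => u \ox Sinv v) _ bm) (bilinear_tsumr _ _ _ bm).
    apply: eq_tsum => a0 a1.
    by rewrite opmul_pure mulr1 !mulrA.
  rewrite -(@coact_coassoc _ _ _ _ (fun a0 a1 a2 =>
      P (a0 \ox (Sinv a1 * Sinv h1)) ((1 : A) \ox (l * h2 * a2)))); last by lin.
  apply: eq_tsum => y a2; rewrite /P !opmulA /coH_embed.
  rewrite (bilinear_tsumr _ _ _ bm) !(bilinear_tsuml _ _ _ bm).
  by apply: eq_tsum => a0 a1; rewrite opmul_pure mul1r.
rewrite exchange_tsum; apply: eq_tsum => a0 z; rewrite exchange_tsum.
(* For the part in [H], inserting [Sinv l2 * l1] supplies the left leg of the conjugation by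
   [l * h * a]. *)
transitivity (\sw_(a1 \ox a2 <- comul z) \sw_(h1 \ox h2 <- comul h)
  \sw_(l1 \ox y <- comul l) \sw_(l2 \ox l3 <- comul y)
   P (a0 \ox (Sinv a1 * Sinv h1 * (Sinv l2 * l1)))
     ((1 : A) \ox (l3 * h2 * a2))).
  apply: eq_tsum => a1 a2; apply: eq_tsum => h1 h2.
  rewrite -(@comul_coassoc _ _ _ (fun l1 l2 l3 =>
   P (a0 \ox (Sinv a1 * Sinv h1 * (Sinv l2 * l1)))
     ((1 : A) \ox (l3 * h2 * a2)))); last by lin.
  rewrite -[LHS](comul_counitlE (G := fun l =>
   P (a0 \ox (Sinv a1 * Sinv h1)) ((1 : A) \ox (l * h2 * a2)))); last by lin.
  apply: eq_tsum => q l3.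
  rewrite (@Sinvl _ (fun z => P (a0 \ox (Sinv a1 * Sinv h1 * z))
     ((1 : A) \ox (l3 * h2 * a2)))); last by lin.
  by rewrite mulr1.
under eq_tsum => a1 a2 do rewrite exchange_tsum.
rewrite exchange_tsum; apply: eq_tsum => l1 y.
rewrite /bimodule_of (linear_tsum _ _ (bm.2 _)) tsum_comulM; last by lin.
rewrite tsum_comulM; last by lin.
rewrite exchange_tsum.
under eq_tsum => h1 h2 do rewrite exchange_tsum.
rewrite exchange_tsum.
apply: eq_tsum => l2 l3; apply: eq_tsum => h1 h2; apply: eq_tsum => a1 a2.
by rewrite /P !opmulA opmul_pure mulr1 !SinvM !mulrA.
Qed.

End Centralizer.

(** * The reference pair *)

Section Reference.
Variables (k : fieldType) (H : finHopfAlgType k) (A : comodAlgType H).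
Local Notation E := (A \ox H)%type.
Local Notation oneE := ((1 : A) \ox (1 : H)).
Local Notation psi := (@psi k H A).
Local Notation opmul := (@opmul k H A).
Local Notation S := (@antipode k H).
Local Notation Sinv := (@antipode_inv k H).
Local Notation opmul_pure := (@opmul_pure k H A).
Let bm := @opmul_bilinear k H A.
Let bp := @psi_bilinear k H A.
Let lS := @antipode_inv_linear k H.

Variables (mu : {scalar H}) (c cinv : A) (Lambda : H) (lambda : {scalar H}).
Hypothesis mu_grouplike : distinguished_grouplike mu.
Hypothesis c_mulV : c * cinv = 1.
Hypothesis c_mulVl : cinv * c = 1.
Hypothesis c_mu : forall a : A,
  a * c = \sw_(a0 \ox a1 <- coact a) mu a1 *: (c * a0).
Hypothesis Lambda_integral : left_integral Lambda.
Hypothesis lambda_integral : right_dual_integral lambda.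
Hypothesis lambda_Lambda : lambda Lambda = 1.

Local Notation antipode_integral :=
  (antipode_integral Lambda_integral lambda_integral lambda_Lambda).
Local Notation lambda_antipode_Lambda :=
  (lambda_antipode_Lambda Lambda_integral lambda_integral lambda_Lambda).
Local Notation lambda_mulC :=
  (lambda_mulC Lambda_integral lambda_integral lambda_Lambda mu_grouplike).
Local Notation integral_mulr :=
  (integral_mulr Lambda_integral lambda_integral lambda_Lambda mu_grouplike).
Local Notation comul_Sinv :=
  (tsum_comul_antipode_inv Lambda_integral lambda_integral lambda_Lambda).

Definition ref_casimir (h h' : H) : E :=
  \sw_(c0 \ox c1 <- coact cinv) lambda (S (h * c1) * h') *: (c0 \ox 1).

Definition ref_central : (E \ox H)%type := (c \ox 1) \ox Lambda.

Lemma ref_casimir_bilinear : bilinear_for *:%R *:%R ref_casimir.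
Proof. by rewrite /ref_casimir; lin. Qed.
Let bB := ref_casimir_bilinear.

Lemma cinv_mu (a : A) :
  cinv * a = \sw_(a0 \ox a1 <- coact a) mu a1 *: (a0 * cinv).
Proof.
have bA := @unital_mul_bilinear k A.
transitivity (cinv * (a * c) * cinv).
  by rewrite -!mulrA c_mulV mulr1.
rewrite c_mu (bilinear_tsumr _ _ _ bA) (bilinear_tsuml _ _ _ bA).
apply: eq_tsum => a0 a1.
by rewrite -unital_scalerAr -unital_scalerAl !mulrA c_mulVl mul1r.
Qed.

(* The twist of [cA] by [mu] compensates for the Nakayama automorphism. *)
Lemma ref_casimir_bimodule h h' (a : A) :
  \sw_(c0 \ox c1 <- coact cinv) lambda (S (h * c1) * h') *: ((c0 * a) \ox (1 : H)) =
  \sw_(a' \ox a2 <- coact a) \sw_(a0 \ox a1 <- coact a')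
    \sw_(c0 \ox c1 <- coact cinv)
      lambda (S (h * (a1 * c1)) * (h' * a2)) *: ((a0 * c0) \ox (1 : H)).
Proof.
pose F u0 u1 b := lambda (S (h * u1 * S b) * h') *: ((u0 : A) \ox (1 : H)).
have tF : trilinear F by rewrite /F; lin.
(* Inserting [d1 * S b2] lets [cinv * a''] be coacted on as a whole, so that [cinv_mu] applies to
   it. *)
transitivity (\sw_(a'' \ox b2 <- coact a) \sw_(u0 \ox u1 <- coact (cinv * a''))
    F u0 u1 b2).
  transitivity (\sw_(c0 \ox c1 <- coact cinv) \sw_(d0 \ox y <- coact a)
     \sw_(d1 \ox b2 <- comul y) F (c0 * d0) (c1 * (d1 * S b2)) 1).
    apply: eq_tsum => c0 c1.
    rewrite -[LHS](coact_counitE (G := fun a =>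
      lambda (S (h * c1) * h') *: ((c0 * a) \ox (1 : H)))); last by lin.
    apply: eq_tsum => d0 y.
    rewrite (@tsum_antipoder _ _ _ (fun z => F (c0 * d0) (c1 * z) 1)); last by lin.
    by rewrite /F antipode1 !mulr1.
  under eq_tsum => c0 c1.
    rewrite -(@coact_coassoc _ _ _ _ (fun d0 d1 b2 =>
      F (c0 * d0) (c1 * (d1 * S b2)) 1)); last by lin.
    over.
  rewrite exchange_tsum; apply: eq_tsum => a'' b2.
  rewrite tsum_coactM; last by lin.
  do 2 (apply: eq_tsum => ? ?).
  by rewrite /F antipode1 mulr1 !mulrA.
(* The factor [mu b1] from [cinv_mu] is the one that [lambda_mulC] produces on the right side, and
   [S b2] inside [F] becomes its [S (S b2)]. *)
pose Phi a' b1 b2 := mu b1 *: \sw_(u0 \ox u1 <- coact (a' * cinv)) F u0 u1 b2.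
have tPhi : trilinear Phi by rewrite /Phi; lin.
transitivity (\sw_(a' \ox z <- coact a) \sw_(b1 \ox b2 <- comul z) Phi a' b1 b2).
  rewrite -(@coact_coassoc _ _ _ _ Phi) //; apply: eq_tsum => a'' b2.
  have lG : linear (fun y => \sw_(u0 \ox u1 <- coact y) F u0 u1 b2) by lin.
  rewrite cinv_mu (linear_tsum _ _ lG); apply: eq_tsum => a' b1.
  by rewrite (linear_funZ _ lG).
apply: eq_tsum => a' a2.
under [RHS]eq_tsum => a0 a1.
  under eq_tsum => c0 c1.
    rewrite mulrA lambda_mulC.
    over.
  rewrite exchange_tsum; over.
rewrite [RHS]exchange_tsum; apply: eq_tsum => b1 b2.
rewrite /Phi tsum_coactM; last by lin.
rewrite scaler_tsum; apply: eq_tsum => a0 a1.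
rewrite scaler_tsum; apply: eq_tsum => c0 c1; congr (_ *: _).
by rewrite /F (antipodeM _ (S b2)) !mulrA.
Qed.

Lemma ref_casimirP : entw_casimir (@comul k H) opmul psi ref_casimir.
Proof.
split=> [h h' e|h h'].
  apply: (tensor_linear_ext (f := fun e => opmul (ref_casimir h h') e)
    (g := fun e => \sw_(x \ox g' <- psi h' e) \sw_(y \ox g <- psi h x)
      opmul y (ref_casimir g g'))); [by lin..|].
  move=> {e} a g.
  transitivity (opmul ((1 : A) \ox g) (\sw_(c0 \ox c1 <- coact cinv)
      lambda (S (h * c1) * h') *: ((c0 * a) \ox (1 : H)))).
    rewrite /ref_casimir (bilinear_tsuml _ _ _ bm) (bilinear_tsumr _ _ _ bm).
    apply: eq_tsum => c0 c1.
    rewrite (linear_funZ _ (bm.1 _)) (linear_funZ _ (bm.2 _)) !opmul_pure.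
    by rewrite mul1r mulr1 mul1r.
  rewrite ref_casimir_bimodule tsum_psi; last by lin.
  rewrite (bilinear_tsumr _ _ _ bm); apply: eq_tsum => a' a2.
  (* The inserted [S g2 * g3] is split between the two arguments of [ref_casimir], with [g2] joining
     [h] and [g3] joining [h']. *)
  transitivity (\sw_(z \ox g3 <- comul g) \sw_(g1 \ox g2 <- comul z)
      \sw_(a0 \ox a1 <- coact a') \sw_(c0 \ox c1 <- coact cinv)
        lambda (S (h * (a1 * c1)) * ((S g2 * g3) * (h' * a2))) *:
          ((a0 * c0) \ox g1)).
    rewrite (@comul_coassoc _ _ _ (fun g1 g2 g3 =>
      \sw_(a0 \ox a1 <- coact a') \sw_(c0 \ox c1 <- coact cinv)
        lambda (S (h * (a1 * c1)) * ((S g2 * g3) * (h' * a2))) *: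
          ((a0 * c0) \ox g1))); last by lin.
    pose G g := \sw_(a0 \ox a1 <- coact a') \sw_(c0 \ox c1 <- coact cinv)
        lambda (S (h * (a1 * c1)) * (h' * a2)) *: ((a0 * c0) \ox (g : H)).
    have lG : linear G by rewrite /G; lin.
    transitivity (G g).
      rewrite (bilinear_tsumr _ _ _ bm); apply: eq_tsum => a0 a1.
      rewrite (bilinear_tsumr _ _ _ bm); apply: eq_tsum => c0 c1.
      by rewrite (linear_funZ _ (bm.2 _)) opmul_pure !mul1r.
    rewrite -[LHS](comul_counitrE _ lG); apply: eq_tsum => g1 y.
    rewrite (@tsum_antipodel _ _ _ (fun z =>
      \sw_(a0 \ox a1 <- coact a') \sw_(c0 \ox c1 <- coact cinv)
        lambda (S (h * (a1 * c1)) * (z * (h' * a2))) *: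
          ((a0 * c0) \ox g1))); last by lin.
    congr (_ *: _); rewrite /G; do 2 (apply: eq_tsum => ? ?).
    by rewrite mul1r.
  apply: eq_tsum => z g3; rewrite tsum_psi; last by lin.
  rewrite exchange_tsum; apply: eq_tsum => a0 a1; apply: eq_tsum => g1 g2.
  rewrite /ref_casimir (bilinear_tsumr _ _ _ bm); apply: eq_tsum => c0 c1.
  rewrite (linear_funZ _ (bm.2 _)) opmul_pure mul1r.
  by rewrite -!(mulrA g2) (antipodeM g2) !mulrA.
transitivity (\sw_(h1 \ox h2 <- comul h) \sw_(c' \ox c2 <- coact cinv)
    \sw_(c0 \ox c1 <- coact c')
      lambda (S (h2 * c2) * h') *: ((c0 \ox (1 : H)) \ox (h1 * c1))).
  apply: eq_tsum => h1 h2; rewrite /ref_casimir (bilinear_tsumr _ _ _ bp).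
  apply: eq_tsum => c' c2; rewrite (linear_funZ _ (bp.2 _)).
  rewrite -[psi _ _]tsum_id tsum_psi; last by lin.
  rewrite scaler_tsum; apply: eq_tsum => c0 c1.
  by rewrite tsum_comul1 ?mul1r //; lin.
transitivity (\sw_(c0 \ox y <- coact cinv) \sw_(g1 \ox g2 <- comul (h * y))
    lambda (S g2 * h') *: ((c0 \ox (1 : H)) \ox g1)).
  under eq_tsum => h1 h2.
    rewrite (@coact_coassoc _ _ _ _ (fun c0 c1 c2 =>
      lambda (S (h2 * c2) * h') *: ((c0 \ox (1 : H)) \ox (h1 * c1))));
      last by lin.
    over.
  rewrite exchange_tsum; apply: eq_tsum => c0 y.
  by rewrite tsum_comulM //; lin.
rewrite /ref_casimir.
under [RHS]eq_tsum => h'1 h'2.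
  rewrite (bilinear_tsuml _ _ _ (pure_tensor_bilinear _ _)); over.
rewrite [RHS]exchange_tsum; apply: eq_tsum => c0 y.
(* Colinearity is the swap identity at [g = h * y]. *)
rewrite (lambda_antipode_swap lambda_integral (G := fun g1 =>
  (c0 \ox (1 : H)) \ox g1)); last by lin.
by apply: eq_tsum => h1 h2; rewrite pure_tensorZl.
Qed.

(** The coring leg [h_2 Lambda a_1] equals [counit(h_2) mu(a_1) Lambda], and
    [mu(a_1) c a_0 = a c]. *)
Lemma ref_centralP : entw_central opmul psi ref_central.
Proof.
move=> e; rewrite /ref_central.
apply: (tensor_linear_ext
  (f := fun e => \sw_(t1 \ox t2 <- (c \ox 1) \ox Lambda) opmul e t1 \ox t2)
  (g := fun e => \sw_(t1 \ox t2 <- (c \ox 1) \ox Lambda)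
     \sw_(x \ox g <- psi t2 e) opmul t1 x \ox g)); [by lin..|].
move=> a h; rewrite !tsum_pure; [|by lin..].
rewrite opmul_pure mul1r tsum_psi; last by lin.
transitivity (\sw_(a0 \ox a1 <- coact a) mu a1 *: (((c * a0) \ox h) \ox Lambda)).
  rewrite c_mu !(bilinear_tsuml _ _ _ (pure_tensor_bilinear _ _)).
  by apply: eq_tsum => a0 a1; rewrite !pure_tensorZl.
apply: eq_tsum => a0 a1.
rewrite -(@comul_counitrE _ _ _ (fun h => mu a1 *: (((c * a0) \ox h) \ox Lambda)));
  last by lin.
apply: eq_tsum => h1 h2; rewrite opmul_pure mulr1 Lambda_integral.
by rewrite -scalerAl integral_mulr !pure_tensorZr.
Qed.

(** [Lambda * c1] yields [mu c1], which together with [c * c0] recombines to [cinv * c = 1] by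
    [c_mu]; the scalar left over is [lambda(S(Lambda) h) = counit h]. *)
Lemma ref_counitl h : \sw_(t1 \ox t2 <- ref_central)
  opmul t1 (ref_casimir t2 h) = counit h *: oneE.
Proof.
rewrite /ref_central tsum_pure; last by lin.
rewrite /ref_casimir (bilinear_tsumr _ _ _ bm) -c_mulVl c_mu.
rewrite (bilinear_tsuml _ _ _ (pure_tensor_bilinear _ _)) scaler_tsum.
apply: eq_tsum => c0 c1; rewrite (linear_funZ _ (bm.2 _)) opmul_pure mulr1.
rewrite integral_mulr linearZ -scalerAl antipode_integral !linearZ /=.
by rewrite lambda_antipode_Lambda mulr1 pure_tensorZl scalerA mulrC.
Qed.

(** The coactions of [c] and [cinv] multiply to that of [1], which leaves [lambda(S(h) Lambda)]. *)
Lemma ref_counitr h : \sw_(t1 \ox t2 <- ref_central)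
  \sw_(x \ox g <- psi h t1) opmul x (ref_casimir g t2) = counit h *: oneE.
Proof.
rewrite /ref_central tsum_pure; last by lin.
rewrite tsum_psi; last by lin.
transitivity (\sw_(u0 \ox u1 <- coact (c * cinv))
    lambda (S (h * u1) * Lambda) *: (u0 \ox (1 : H))).
  rewrite tsum_coactM; last by lin.
  apply: eq_tsum => a0 a1; rewrite tsum_comul1; last by lin.
  rewrite /ref_casimir (bilinear_tsumr _ _ _ bm); apply: eq_tsum => c0 c1.
  by rewrite (linear_funZ _ (bm.2 _)) opmul_pure !mul1r mulrA.
rewrite c_mulV tsum_coact1; last by lin.
by rewrite mulr1 Lambda_integral linearZ /= lambda_Lambda mulr1 counit_antipode.
Qed.

Lemma ref_frobenius :
  entw_frobenius (@comul k H) (@counit k H) oneE opmul psi ref_casimir ref_central.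
Proof.
split; [exact: ref_casimirP | exact: ref_centralP | exact: ref_counitl |].
exact: ref_counitr.
Qed.

Lemma twist_ref_central x :
  twist_central (@comul k H) opmul (bimodule_of x) ref_central =
  tassoc (\sw_(b \ox u <- x) \sw_(L1 \ox L2 \ox L3 <- comul2 Lambda)
    (c * b) \ox (L2 * u * Sinv L1) \ox L3).
Proof.
have bb := @bimodule_of_bilinear k H A; have lt := @tassoc_linear k H A.
have bA := @unital_mul_bilinear k A.
apply: (tensor_linear_ext (f := fun x =>
    twist_central (@comul k H) opmul (bimodule_of x) ref_central)
  (g := fun x => tassoc (\sw_(b \ox u <- x)
    \sw_(L1 \ox L2 \ox L3 <- comul2 Lambda)
      (c * b) \ox (L2 * u * Sinv L1) \ox L3))).
- by rewrite /twist_central; lin.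
- by lin.
move=> b u; rewrite /twist_central /ref_central tsum_pure; last by lin.
rewrite tsum_pure; last by lin.
rewrite tsum_comul2; last by lin.
rewrite -comul_coassoc; last by lin.
rewrite (linear_tsum _ _ lt); apply: eq_tsum => p L3.
rewrite /bimodule_of (linear_tsum _ _ lt) (bilinear_tsumr _ _ _ bm).
rewrite (bilinear_tsuml _ _ _ (pure_tensor_bilinear _ _)).
apply: eq_tsum => L1 L2.
by rewrite tassoc_pure !opmul_pure !mul1r !mulr1 mulrA.
Qed.

(** Unfolding gives five legs of [h']. The last two meet as [S p4 * q] and cancel, which leaves the
    three legs of the closed formula. *)
Lemma twist_ref_casimir x h h' :
  twist_casimir (@comul k H) opmul psi (bimodule_of x) ref_casimir h h' =
  \sw_(b \ox u <- x) \sw_(b0 \ox b1 <- coact b) \sw_(c0 \ox c1 <- coact cinv)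
    \sw_(u1 \ox u2 <- comul u) \sw_(h'1 \ox h'2 \ox h'3 <- comul2 h')
      lambda (S (u2 * Sinv h'1 * h * b1 * c1)) *:
        ((b0 * c0) \ox (h'3 * u1 * Sinv h'2)).
Proof.
have bb := @bimodule_of_bilinear k H A.
apply: (tensor_linear_ext (f := fun x =>
    twist_casimir (@comul k H) opmul psi (bimodule_of x) ref_casimir h h')
  (g := fun x => \sw_(b \ox u <- x) \sw_(b0 \ox b1 <- coact b)
    \sw_(c0 \ox c1 <- coact cinv) \sw_(u1 \ox u2 <- comul u)
      \sw_(h'1 \ox h'2 \ox h'3 <- comul2 h')
      lambda (S (u2 * Sinv h'1 * h * b1 * c1)) *:
        ((b0 * c0) \ox (h'3 * u1 * Sinv h'2)))).
- by rewrite /twist_casimir; lin.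
- by lin.
move=> {x} b u; rewrite tsum_pure; last by lin.
pose G b0 b1 c0 c1 u1 u2 p1 p2 p3 w :=
  lambda (S (u2 * Sinv p1 * h * b1 * c1) * w) *:
    (((b0 : A) * (c0 : A)) \ox (p3 * u1 * Sinv p2)).
transitivity (\sw_(b0 \ox b1 <- coact b) \sw_(c0 \ox c1 <- coact cinv)
    \sw_(u1 \ox u2 <- comul u) \sw_(p \ox q <- comul h')
      \sw_(pa \ox pb <- comul p) \sw_(p3 \ox p4 <- comul pb)
        \sw_(p1 \ox p2 <- comul pa) G b0 b1 c0 c1 u1 u2 p1 p2 p3 (S p4 * q)).
  transitivity (\sw_(p \ox q <- comul h') \sw_(pa \ox pb <- comul p)
      \sw_(b0 \ox b1 <- coact b) \sw_(l1 \ox l2 <- comul (pb * u * Sinv pa))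
        \sw_(c0 \ox c1 <- coact cinv)
          lambda (S (l2 * h * b1 * c1) * q) *: ((b0 * c0) \ox l1)).
    apply: eq_tsum => p q; rewrite /bimodule_of.
    rewrite (bilinear_tsumr _ _ _ bp) tsum_tsum; last by lin.
    apply: eq_tsum => pa pb; rewrite !opmul_pure !mul1r mulr1 mulrA.
    rewrite tsum_psi; last by lin.
    apply: eq_tsum => b0 b1; apply: eq_tsum => l1 l2.
    rewrite /ref_casimir (bilinear_tsumr _ _ _ bm); apply: eq_tsum => c0 c1.
    by rewrite (linear_funZ _ (bm.2 _)) opmul_pure mul1r.
  under eq_tsum => p q do rewrite exchange_tsum.
  rewrite exchange_tsum; apply: eq_tsum => b0 b1.
  under [RHS]eq_tsum => c0 c1 do rewrite exchange_tsum.
  rewrite [RHS]exchange_tsum; apply: eq_tsum => p q.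
  under [RHS]eq_tsum => c0 c1 do rewrite exchange_tsum.
  rewrite [RHS]exchange_tsum; apply: eq_tsum => pa pb.
  rewrite exchange_tsum; apply: eq_tsum => c0 c1.
  rewrite tsum_comulM; last by lin.
  rewrite tsum_comulM; last by lin.
  rewrite exchange_tsum; apply: eq_tsum => u1 u2.
  apply: eq_tsum => p3 p4; rewrite comul_Sinv; last by lin.
  apply: eq_tsum => p1 p2; rewrite /G.
  by rewrite -!(mulrA p4) (antipodeM p4) !mulrA.
apply: eq_tsum => b0 b1; apply: eq_tsum => c0 c1; apply: eq_tsum => u1 u2.
pose Q pa p3 w := \sw_(p1 \ox p2 <- comul pa) G b0 b1 c0 c1 u1 u2 p1 p2 p3 w.
have tQ : trilinear Q by rewrite /Q /G; lin.
transitivity (\sw_(pa \ox z <- comul h') Q pa z 1).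
  rewrite (@comul_coassoc _ _ _ (fun pa pb q => \sw_(p3 \ox p4 <- comul pb)
    Q pa p3 (S p4 * q))); last by lin.
  apply: eq_tsum => pa z.
  rewrite (@comul_coassoc _ _ _ (fun p3 p4 q => Q pa p3 (S p4 * q)));
    last by lin.
  have lQ : linear (fun z => Q pa z 1) by lin.
  rewrite -[RHS](comul_counitrE _ lQ); apply: eq_tsum => p3 y.
  by rewrite (@tsum_antipodel _ _ _ (fun w => Q pa p3 w)) //; lin.
rewrite tsum_comul2; last by lin.
rewrite -comul_coassoc; last by lin.
rewrite /Q /G; apply: eq_tsum => pa z; apply: eq_tsum => p1 p2.
by rewrite mulr1.
Qed.

End Reference.

Theorem theorem3p20 (k : fieldType) (H : finHopfAlgType k) (A : comodAlgType H)
    (mu : {scalar H}) (mu_grouplike : distinguished_grouplike mu)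
    (cA cAinv : A) (cA_mulV : cA * cAinv = 1) (cA_mulVl : cAinv * cA = 1)
    (cA_mu : forall a : A,
       a * cA = \sw_(a0 \ox a1 <- coact a) mu a1 *: (cA * a0))
    (Lambda : H) (Lambda_integral : left_integral Lambda)
    (lambda : {scalar H}) (lambda_integral : right_dual_integral lambda)
    (lambda_Lambda : lambda Lambda = 1)
    (B' : {linear (H \ox H)%type -> (A \ox H)%type}) (t' : A \ox (H \ox H)) :
  frobenius_pair B' t' <->
  exists x xinv : A \ox H,
    [/\ coH_centralizer x, op_inverse x xinv,
        forall h h' : H,
          B' (h \ox h') =
          \sw_(b \ox u <- xinv) \sw_(b0 \ox b1 <- coact b)
            \sw_(c0 \ox c1 <- coact cAinv)
              \sw_(u1 \ox u2 <- comul u)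
                \sw_(h'1 \ox h'2 \ox h'3 <- comul2 h')
                  lambda (antipode (u2 * antipode_inv h'1 * h * b1 * c1)) *:
                    ((b0 * c0) \ox (h'3 * u1 * antipode_inv h'2))
      & t' =
        \sw_(b \ox u <- x) \sw_(L1 \ox L2 \ox L3 <- comul2 Lambda)
          (cA * b) \ox (L2 * u * antipode_inv L1) \ox L3].
Proof.
have bm := @opmul_bilinear k H A; have bp := @psi_bilinear k H A.
have mA := @opmulA k H A; have m1l := @opmul1l k H A; have m1r := @opmul1r k H A.
have pM := @psi_mul k H A; have p1 := @psi_one k H A; have pD := @psi_comul k H A.
have cA' := @comul_coassoc k H.
have cl := @comul_counitl k H; have cr := @comul_counitr k H.
have bB0 := @ref_casimir_bilinear k H A cAinv lambda.
have fB0 := ref_frobenius mu_grouplike cA_mulV cA_mulVl cA_mu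
  Lambda_integral lambda_integral lambda_Lambda.
have [CB0 ct0 _ _] := fB0.
have bB' := @curry_tensor_bilinear k H A B'.
set t0 := ref_central cA Lambda in fB0 ct0.
set B0 := ref_casimir cAinv lambda in bB0 fB0 CB0.
have tB0 x := @twist_ref_casimir k H A cAinv Lambda lambda
  Lambda_integral lambda_integral lambda_Lambda x.
split=> [/frobenius_pairP fB'|[x [xinv [Cx xxinv B'E t'E]]]].
  have [CB' ct' _ _] := fB'.
  pose phi := pair_casimir (@opmul k H A) B0 (tassoc t').
  pose psibar := pair_casimir (@opmul k H A) (curry_tensor B') t0.
  have lphi : linear phi by exact: pair_casimir_linear.
  have lpsi : linear psibar by exact: pair_casimir_linear.
  have Zphi : entw_bimodule_map (@opmul k H A) (@psi k H A) phi.
    by apply: pair_casimir_bimodule CB0 ct'.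
  have Zpsi : entw_bimodule_map (@opmul k H A) (@psi k H A) psibar.
    by apply: pair_casimir_bimodule CB' ct0.
  have Ephi : phi = bimodule_of (phi 1).
    by apply/boolp.funext => h; apply: bimodule_mapE lphi Zphi h.
  have Epsi : psibar = bimodule_of (psibar 1).
    by apply/boolp.funext => h; apply: bimodule_mapE lpsi Zpsi h.
  exists (phi 1), (psibar 1); split.
  - exact: bimodule_map_centralizer lphi Zphi.
  - split.
      (* [1] is grouplike, so the convolution identity at [1] is an identity between products in
         [A \ox H^op]. *)
      have := pair_casimir_convolution bm mA m1r bp cr pM p1 pD 1 bB' bB0 fB' fB0.
      by rewrite tsum_comul1 ?counit1 ?scale1r //; lin.
    have := pair_casimir_convolution bm mA m1r bp cr pM p1 pD 1 bB0 bB' fB0 fB'.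
    by rewrite tsum_comul1 ?counit1 ?scale1r //; lin.
  - move=> h h'; rewrite -tB0 -Epsi.
    exact: (twist_casimir_pair bm mA m1l bp cr pM p1 pD h h' bB0 bB' fB0 fB').
  apply: (can_inj (@tassocK k H A)); rewrite -twist_ref_central -Ephi.
  exact: (twist_central_pair bm mA m1r bp cr pM p1 pD bB0 fB0 ct').
(* The map built from [xinv] must also be right linear in order to twist the reference pair. *)
have Cxinv := coH_centralizer_inverse Cx xxinv.
apply/frobenius_pairP; rewrite t'E -twist_ref_central.
have -> : curry_tensor B' =
    twist_casimir (@comul k H) (@opmul k H A) (@psi k H A) (bimodule_of xinv) B0.
  by apply/boolp.funext => h; apply/boolp.funext => h'; rewrite tB0 -B'E.
have [xy yx] := xxinv.
apply: (twist_frobenius bm mA m1l m1r bp cA' cl pM pD bB0 fB0).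
- exact: bimodule_of_linear.
- exact: bimodule_of_linear.
- exact: bimodule_ofP Cx.
- exact: bimodule_ofP Cxinv.
- move=> h.
  rewrite (bimodule_of_mul Lambda_integral lambda_integral lambda_Lambda).
  by rewrite [opmul x xinv]xy
    (bimodule_of_one A Lambda_integral lambda_integral lambda_Lambda).
- move=> h.
  rewrite (bimodule_of_mul Lambda_integral lambda_integral lambda_Lambda).
  by rewrite [opmul xinv x]yx
    (bimodule_of_one A Lambda_integral lambda_integral lambda_Lambda).
Qed.
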